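(* Let $\mathcal F=(F;+,\cdot,0,1,\mathrm D)$ be a saturated differentially closed field of characteristic $0$, $t\in F$ with $\mathrm D t=1$ a constant of the language, $k_0=\mathbb Q(t)$, $R$ a collection of relations on $F$ each definable without parameters in $\{+,\cdot,0,1,t,\mathrm D\}$, and $\mathcal F_R=(F;+,\cdot,0,1,t,P)_{P\in R}$. Let $a\in F$ be differentially transcendental over $k_0$, and let $T^+_R$ be the theory of $\mathcal F_R$ in the language $\{+,\cdot,0,1,t,a\}\cup R$ (with a new constant symbol for $a$). Suppose every model $\mathcal K_R=(K;+,\cdot,0,1,t,a,P)_{P\in R}$ of $T^+_R$ is the reduct of a differentially closed field, i.e. there is a derivation $\mathrm D_K$ on $K$ such that $(K;+,\cdot,0,1,t,a,\mathrm D_K,P)_{P\in R}\equiv(F;+,\cdot,0,1,t,a,\mathrm D,P)_{P\in R}$. Then $\mathrm D$ is definable in $\mathcal F_R$.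
   Context: ''$\mathrm D$ is definable'' means the graph $\{(x,\mathrm Dx)\}$ is definable in $\mathcal F_R$ without parameters. *)

(* Defs.v *)
From Stdlib Require List.
From mathcomp Require Import all_boot all_order all_algebra.
From mathcomp Require Import mpoly.

Set Implicit Arguments.
Unset Strict Implicit.
Unset Printing Implicit Defensive.

Import GRing.Theory.
Local Open Scope ring_scope.

(* Constants are 0-ary function symbols; equality is a logical symbol. *)
Record language := Language {
  fsym : Type;
  far : fsym -> nat;
  rsym : Type;
  rar : rsym -> nat }.

Arguments far : clear implicits.
Arguments rar : clear implicits.

Inductive term (L : language) (n : nat) : Type :=
| Var of 'I_n
| App (f : fsym L) of ('I_(far L f) -> term L n).

(* [formula L n] has its free variables among 'I_n.  In [All phi] the bound
   variable is variable 0 of [phi], the others being shifted by one.  The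
   remaining connectives are the usual classical abbreviations. *)
Inductive formula (L : language) : nat -> Type :=
| Fls n : formula L n
| Eq n of term L n & term L n : formula L n
| Rel n (r : rsym L) of ('I_(rar L r) -> term L n) : formula L n
| Imp n of formula L n & formula L n : formula L n
| All n of formula L n.+1 : formula L n.

Notation sentence L := (formula L 0).

Record interp (L : language) (M : Type) := Interp {
  fint : forall f : fsym L, (far L f).-tuple M -> M;
  rint : forall r : rsym L, (rar L r).-tuple M -> Prop }.

Section Semantics.
Variables (L : language) (M : Type) (I : interp L M).

Fixpoint teval n (v : n.-tuple M) (u : term L n) : M :=
  match u with
  | Var i => tnth v i
  | App f args => fint I (f := f) [tuple teval v (args i) | i < far L f]
  end.

Fixpoint sat n (phi : formula L n) : n.-tuple M -> Prop :=
  match phi with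
  | Fls _ => fun=> False
  | Eq _ u1 u2 => fun v => teval v u1 = teval v u2
  | Rel _ r args =>
      fun v => rint I (r := r) [tuple teval v (args i) | i < rar L r]
  | Imp _ phi1 phi2 => fun v => sat phi1 v -> sat phi2 v
  | All _ phi1 => fun v => forall x : M, sat phi1 [tuple of x :: v]
  end.

Definition holds (phi : sentence L) : Prop := sat phi [tuple].

Definition theory : sentence L -> Prop := fun phi => holds phi.

Definition is_model (T : sentence L -> Prop) : Prop :=
  forall phi, T phi -> holds phi.

Definition definable n (S : n.-tuple M -> Prop) : Prop :=
  exists phi : formula L n, forall v, sat phi v <-> S v.

End Semantics.

Definition elem_equiv (L : language) (M N : Type)
    (I : interp L M) (J : interp L N) : Prop :=
  forall phi : sentence L, holds I phi <-> holds J phi.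

Definition lsum (L1 L2 : language) : language :=
  @Language (fsym L1 + fsym L2)
    (fun f => match f with inl f1 => far L1 f1 | inr f2 => far L2 f2 end)
    (rsym L1 + rsym L2)
    (fun r => match r with inl r1 => rar L1 r1 | inr r2 => rar L2 r2 end).

Definition isum (L1 L2 : language) (M : Type)
    (I1 : interp L1 M) (I2 : interp L2 M) : interp (lsum L1 L2) M :=
  @Interp (lsum L1 L2) M
    (fun f => match f with
              | inl f1 => fint I1 (f := f1) | inr f2 => fint I2 (f := f2) end)
    (fun r => match r with
              | inl r1 => rint I1 (r := r1) | inr r2 => rint I2 (r := r2) end).

Definition reductl (L1 L2 : language) (M : Type)
    (I : interp (lsum L1 L2) M) : interp L1 M :=
  @Interp L1 M (fun f => fint I (f := inl f)) (fun r => rint I (r := inl r)).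

Definition Lconst (C : Type) : language :=
  @Language C (fun=> 0%N) void (fun=> 0%N).

Definition iconst (C M : Type) (c : C -> M) : interp (Lconst C) M :=
  @Interp (Lconst C) M (fun f _ => c f) (fun r => match r with end).

Definition Lfun1 : language := @Language unit (fun=> 1%N) void (fun=> 0%N).

Definition ifun1 (M : Type) (g : M -> M) : interp Lfun1 M :=
  @Interp Lfun1 M (fun _ (v : 1.-tuple M) => g (thead v))
    (fun r => match r with end).

Definition Lrel (J : Type) (ar : J -> nat) : language :=
  @Language void (fun=> 0%N) J ar.

Definition irel (J : Type) (ar : J -> nat) (M : Type)
    (P : forall j, (ar j).-tuple M -> Prop) : interp (Lrel ar) M :=
  @Interp (Lrel ar) M (fun f => match f with end) P.

Inductive ring_fsym := RAdd | RMul | RZero | ROne.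

Definition ring_far (f : ring_fsym) : nat :=
  match f with RAdd | RMul => 2 | RZero | ROne => 0 end.

Definition Lring : language :=
  @Language ring_fsym ring_far void (fun=> 0%N).

Definition ring_fint (F : fieldType) (f : ring_fsym) :
    (ring_far f).-tuple F -> F :=
  match f with
  | RAdd => fun v : 2.-tuple F => tnth v ord0 + tnth v ord_max
  | RMul => fun v : 2.-tuple F => tnth v ord0 * tnth v ord_max
  | RZero => fun=> 0
  | ROne => fun=> 1
  end.

Definition iring (F : fieldType) : interp Lring F :=
  @Interp Lring F (@ring_fint F) (fun r => match r with end).

Definition iadd (M : Type) (I : interp Lring M) (x y : M) : M :=
  fint I (f := RAdd) [tuple x; y].

Definition imul (M : Type) (I : interp Lring M) (x y : M) : M :=
  fint I (f := RMul) [tuple x; y].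

(* #A < #M, which classically means that M does not inject into A. *)
Definition small (M : Type) (A : M -> Prop) : Prop :=
  ~ exists f : M -> {x : M | A x}, injective f.

Definition finitely_satisfiable (L : language) (M : Type) (I : interp L M)
    n (p : formula L n -> Prop) : Prop :=
  forall s : seq (formula L n), (forall phi, List.In phi s -> p phi) ->
  exists v : n.-tuple M, forall phi, List.In phi s -> sat I phi v.

Definition realized (L : language) (M : Type) (I : interp L M)
    n (p : formula L n -> Prop) : Prop :=
  exists v : n.-tuple M, forall phi, p phi -> sat I phi v.

(* Saturated in its own cardinality: every n-type over fewer than #M
   parameters is realized. *)
Definition saturated (L : language) (M : Type) (I : interp L M) : Prop :=
  forall A : M -> Prop, small A ->
  forall n (p : formula (lsum L (Lconst {x : M | A x})) n -> Prop),
  let IA := isum I (iconst (fun c : {x : M | A x} => sval c)) in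
  finitely_satisfiable IA p -> realized IA p.

Definition derivation (M : Type) (add mul : M -> M -> M) (D : M -> M) : Prop :=
  (forall x y, D (add x y) = add (D x) (D y)) /\
  (forall x y, D (mul x y) = add (mul x (D y)) (mul (D x) y)).

Section DifferentialFields.
Variables (F : fieldType) (D : F -> F).

(* A differential polynomial in one indeterminate, of order < n, is a
   polynomial in n variables evaluated at x, D x, ..., D^(n-1) x. *)
Definition dpeval n (f : {mpoly F[n]}) (x : F) : F :=
  f.@[fun i : 'I_n => iter i D x].

Definition has_order n (f : {mpoly F[n.+1]}) : Prop :=
  exists2 m : 'X_{1..n.+1}, m \in msupp f & m ord_max != 0%N.

(* Blum's definition: if f has order n and g is nonzero of order < n, then
   f(x) = 0 and g(x) <> 0 for some x.  Constants have order -1, and the case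
   n = 0 says that F is algebraically closed. *)
Definition diff_closed : Prop :=
  forall n (f : {mpoly F[n.+1]}) (g : {mpoly F[n]}),
  has_order f -> g != 0 ->
  exists x : F, dpeval f x = 0 /\ dpeval g x != 0.

Definition DCF0 : Prop :=
  [/\ [pchar F] =i pred0, derivation +%R *%R D & diff_closed].

Definition diff_transcendental (k : F -> Prop) (a : F) : Prop :=
  forall n (f : {mpoly F[n]}), (forall m, k f@_m) -> dpeval f a = 0 -> f = 0.

Definition graph : 2.-tuple F -> Prop := fun v => exists x, v = [tuple x; D x].

End DifferentialFields.

(* Membership in the subfield Q(t); meaningful in characteristic 0 only. *)
Definition Q_adjoin (F : fieldType) (t x : F) : Prop :=
  exists p q : {poly rat},
    (map_poly ratr q).[t] != 0 /\
    x = (map_poly ratr p).[t] / (map_poly ratr q).[t].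

Section Structures.
Variables (F : fieldType) (D : F -> F) (t a : F).
Variables (J : Type) (ar : J -> nat) (R : forall j, (ar j).-tuple F -> Prop).

Definition i_D : interp (lsum Lring Lfun1) F := isum (iring F) (ifun1 D).

Definition Lt : language := lsum Lring (Lconst unit).
Definition i_t : interp Lt F := isum (iring F) (iconst (fun=> t)).

Definition i_tD : interp (lsum Lt Lfun1) F := isum i_t (ifun1 D).

Definition LR : language := lsum Lt (Lrel ar).
Definition i_R : interp LR F := isum i_t (irel R).

Definition LRa : language := lsum LR (Lconst unit).
Definition i_Ra : interp LRa F := isum i_R (iconst (fun=> a)).

End Structures.

Definition ring_of (J : Type) (ar : J -> nat) (K : Type)
    (I : interp (LRa ar) K) : interp Lring K :=
  reductl (reductl (reductl I)).

(* Main.v *)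
(* The elements of N[t] are values of closed terms, and no nonzero differential
   polynomial vanishes on all of N[t], since their jets are Zariski dense.  Call
   a definable binary relation Y of F_R thin if Y(y, x) forces y to be
   differentially algebraic over x.  The set K of all b with Y(b, a) for some
   thin Y is an elementary substructure of F_R: a nonempty definable set with
   parameters in K either consists of elements differentially algebraic over
   these, hence lies in K, or contains every generic element, hence meets N[t]
   by compactness.  The derivation D_K given by the hypothesis sends a into K,
   so that Y(D_K a, a), and therefore Y(D a, a), for some thin Y.

   Let now (D x, x) and (y', x') have the same type in F_R and u = y' - D x'.
   For r, s in N[t] the derivatives of r and s are terms, so that Y holds at
   (D (r x + s), r x + s) only if it holds at (D (r x' + s) + r u, r x' + s).
   By compactness this is also true of some generic pair (r, s), for which the
   first point is in Y because r x + s has the type of a.  If u were nonzero,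
   then the second point would be a generic pair, against thinness.  Hence
   D x' = y', and a compactness argument makes the graph of D definable.

   Genericity determines types because differentially closed fields have
   quantifier elimination, obtained here by back and forth. *)

From Stdlib Require List.
From HB Require Import structures.
From mathcomp Require Import all_boot all_order all_algebra boolp.
From mathcomp Require Import mpoly zify ring.
Require Import Defs.

Set Implicit Arguments.
Unset Strict Implicit.
Unset Printing Implicit Defensive.

Import GRing.Theory.
Local Open Scope ring_scope.

(** * First-order definability *)

Definition econs M (x : M) (e : nat -> M) (i : nat) : M :=
  if i is j.+1 then e j else x.
Notation "x .: e" := (econs x e) (at level 60, right associativity).

Definition etup M n (e : nat -> M) : n.-tuple M := [tuple e i | i < n].

Lemma etup_cons M n x (e : nat -> M) :
  etup n.+1 (x .: e) = [tuple of x :: etup n e].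
Proof.
apply: eq_from_tnth => i; rewrite tnth_mktuple.
by case: (unliftP ord0 i) => [j|] ->; rewrite ?tnth0 // tnthS tnth_mktuple.
Qed.

Lemma etup_nth M n x0 (v : n.-tuple M) : etup n (nth x0 v) = v.
Proof. by apply: eq_from_tnth => i; rewrite tnth_mktuple -tnth_nth. Qed.

Lemma eq_etup M n (e e' : nat -> M) :
  (forall i, (i < n)%N -> e i = e' i) -> etup n e = etup n e'.
Proof. by move=> h; apply: eq_from_tnth => i; rewrite !tnth_mktuple h. Qed.

Section TermSubst.
Variables (L : language) (k n : nat) (s : 'I_k -> term L n).

Fixpoint tsubst (u : term L k) : term L n :=
  match u with
  | Var i => s i
  | App f args => App (fun i => tsubst (args i))
  end.

Lemma teval_tsubst M (I : interp L M) (v : n.-tuple M) u :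
  teval I v (tsubst u) = teval I [tuple teval I v (s i) | i < k] u.
Proof.
elim: u => [i|f args IH] /=; first by rewrite tnth_mktuple.
by congr fint; apply: eq_from_tnth => i; rewrite !tnth_mktuple IH.
Qed.

End TermSubst.

Definition tshift L n (u : term L n) : term L n.+1 :=
  tsubst (fun i => Var L (lift ord0 i)) u.

Lemma teval_tshift L M (I : interp L M) n x (v : n.-tuple M) u :
  teval I [tuple of x :: v] (tshift u) = teval I v u.
Proof.
rewrite /tshift teval_tsubst; congr teval.
by apply: eq_from_tnth => i; rewrite tnth_mktuple /= tnthS.
Qed.

(* [P] isolates the assignments at which the symbols of [L1] agree with their
   translations; the index [x] makes one translation serve several
   structures. *)
Section Translation.
Variables (L1 L2 : language) (X : Type) (M : X -> Type).
Variables (I1 : forall x, interp L1 (M x)) (I2 : forall x, interp L2 (M x)).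
Variable P : forall x n, n.-tuple (M x) -> Prop.
Hypothesis P_cons :
  forall x n y (v : n.-tuple (M x)), P v -> P [tuple of y :: v].
Hypothesis fun_trans : forall f n (us : 'I_(far L1 f) -> term L2 n),
  exists u : term L2 n, forall x (v : n.-tuple (M x)), P v ->
  teval (I2 x) v u =
  fint (I1 x) (f := f) [tuple teval (I2 x) v (us i) | i < far L1 f].
Hypothesis rel_trans : forall r n (us : 'I_(rar L1 r) -> term L2 n),
  exists psi : formula L2 n, forall x (v : n.-tuple (M x)), P v ->
  sat (I2 x) psi v <->
  rint (I1 x) (r := r) [tuple teval (I2 x) v (us i) | i < rar L1 r].

Lemma term_translation k n (s : 'I_k -> term L2 n) (u : term L1 k) :
  exists u' : term L2 n, forall x (v : n.-tuple (M x)), P v ->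
  teval (I2 x) v u' = teval (I1 x) [tuple teval (I2 x) v (s i) | i < k] u.
Proof.
elim: u => [i|f args IH] /=.
  by exists (s i) => x v _; rewrite tnth_mktuple.
have [us Hus] := choice IH; have [u Hu] := fun_trans us.
exists u => x v Pv; rewrite Hu //; congr fint.
by apply: eq_from_tnth => i; rewrite !tnth_mktuple Hus.
Qed.

Lemma formula_translation k (phi : formula L1 k) n (s : 'I_k -> term L2 n) :
  exists psi : formula L2 n, forall x (v : n.-tuple (M x)), P v ->
  sat (I2 x) psi v <-> sat (I1 x) phi [tuple teval (I2 x) v (s i) | i < k].
Proof.
elim: phi n s => {k} [k|k u1 u2|k r args|k phi1 IH1 phi2 IH2|k phi IH] n s.
- by exists (Fls L2 n).
- have [u1' H1] := term_translation s u1;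
    have [u2' H2] := term_translation s u2.
  by exists (Eq u1' u2') => x v Pv /=; rewrite H1 // H2.
- have [us Hus] := choice (fun i => term_translation s (args i)).
  have [psi Hpsi] := rel_trans us; exists psi => x v Pv; rewrite Hpsi //=.
  rewrite (_ : [tuple _ | i < _] =
    [tuple teval (I1 x) [tuple teval (I2 x) v (s i) | i < k] (args i)
      | i < rar L1 r]) //.
  by apply: eq_from_tnth => i; rewrite !tnth_mktuple Hus.
- have [psi1 H1] := IH1 n s; have [psi2 H2] := IH2 n s.
  by exists (Imp psi1 psi2) => x v Pv /=; rewrite H1 // H2.
- pose s' (i : 'I_k.+1) : term L2 n.+1 :=
    if unlift ord0 i is Some j then tshift (s j) else Var L2 ord0.
  have [psi Hpsi] := IH n.+1 s'; exists (All psi) => x v Pv /=.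
  suff E y : [tuple teval (I2 x) [tuple of y :: v] (s' i) | i < k.+1] =
             [tuple of y :: [tuple teval (I2 x) v (s i) | i < k]].
    split=> H y; have /Hpsi := P_cons y Pv; rewrite E => Hy.
      by apply/Hy.
    by apply/Hy.
  apply: eq_from_tnth => i; rewrite tnth_mktuple /s'.
  case: unliftP => [j|] ->; last by rewrite /= !tnth0.
  by rewrite tnthS tnth_mktuple teval_tshift.
Qed.

End Translation.

Section Definability.
Variables (L : language) (M : Type) (I : interp L M).
Implicit Types (S : (nat -> M) -> Prop) (T : (nat -> M) -> M).

(* Assignments are infinite sequences, of which a formula with [n] free
   variables reads the first [n] values; this avoids casts between tuples. *)
Definition Def n S :=
  exists phi : formula L n, forall e, sat I phi (etup n e) <-> S e.
Definition Ter n T :=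
  exists u : term L n, forall e, teval I (etup n e) u = T e.

Lemma Def_ext n S S' : Def n S -> (forall e, S e <-> S' e) -> Def n S'.
Proof. by case=> phi H E; exists phi => e; rewrite H. Qed.

Lemma Ter_ext n T T' : Ter n T -> T =1 T' -> Ter n T'.
Proof. by case=> u H E; exists u => e; rewrite H. Qed.

Lemma Def_local n S e e' : Def n S ->
  (forall i, (i < n)%N -> e i = e' i) -> S e <-> S e'.
Proof. by case=> phi H /eq_etup E; rewrite -!H E. Qed.

Lemma Ter_var n i : (i < n)%N -> Ter n (fun e => e i).
Proof.
by move=> h; exists (Var L (Ordinal h)) => e; rewrite /= tnth_mktuple.
Qed.

Lemma Ter_app n (f : fsym L) (T : 'I_(far L f) -> (nat -> M) -> M) :
  (forall i, Ter n (T i)) ->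
  Ter n (fun e => fint I (f := f) [tuple T i e | i < far L f]).
Proof.
move=> /choice[us Hus]; exists (App us) => e /=; congr fint.
by apply: eq_from_tnth => i; rewrite !tnth_mktuple Hus.
Qed.

Lemma Def_False n : Def n (fun=> False).
Proof. by exists (Fls L n). Qed.

Lemma Def_imp n S S' : Def n S -> Def n S' -> Def n (fun e => S e -> S' e).
Proof. by move=> [p Hp] [q Hq]; exists (Imp p q) => e /=; rewrite Hp Hq. Qed.

Lemma Def_not n S : Def n S -> Def n (fun e => ~ S e).
Proof. by move=> h; apply: Def_imp h (Def_False n). Qed.

Lemma Def_and n S S' : Def n S -> Def n S' -> Def n (fun e => S e /\ S' e).
Proof.
move=> h h'; apply: Def_ext (Def_not (Def_imp h (Def_not h'))) _ => e.
by split=> [/not_implyP[? /contrapT]|[? ?]] //; auto.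
Qed.

Lemma Def_or n S S' : Def n S -> Def n S' -> Def n (fun e => S e \/ S' e).
Proof.
move=> h h'; apply: Def_ext (Def_imp (Def_not h) h') _ => e.
by split=> [H|[]//]; case: (pselect (S e)); auto.
Qed.

Lemma Def_all n S : Def n.+1 S -> Def n (fun e => forall x, S (x .: e)).
Proof.
case=> phi H; exists (All phi) => e /=.
by split=> h x; have := h x; rewrite -H etup_cons.
Qed.

Lemma Def_ex n S : Def n.+1 S -> Def n (fun e => exists x, S (x .: e)).
Proof.
move=> h; apply: Def_ext (Def_not (Def_all (Def_not h))) _ => e.
by split=> [/existsNP[x /contrapT]|[x ? /(_ x)]] //; exists x.
Qed.

Lemma Def_eq n T T' : Ter n T -> Ter n T' -> Def n (fun e => T e = T' e).
Proof. by move=> [u Hu] [w Hw]; exists (Eq u w) => e /=; rewrite Hu Hw. Qed.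

Lemma Def_fin n (A : finType) (S : A -> (nat -> M) -> Prop) :
  (forall i, Def n (S i)) -> Def n (fun e => forall i, S i e).
Proof.
move=> h; suff hs (s : seq A) : Def n (fun e => forall i, i \in s -> S i e).
  apply: Def_ext (hs (enum A)) _ => e.
  by split=> H i; [apply: H; rewrite mem_enum|move=> _; apply: H].
elim: s => [|i s IH].
  by apply: Def_ext (Def_not (Def_False n)) _ => e; split=> // _ [].
apply: Def_ext (Def_and (h i) IH) _ => e; split=> [[Hi Hs] j|H].
  by rewrite inE => /orP[/eqP->|/Hs].
by split=> [|j js]; apply: H; rewrite inE ?eqxx // js orbT.
Qed.

Lemma Def_seq_all n (s : seq ((nat -> M) -> Prop)) :
  (forall S, List.In S s -> Def n S) ->
  Def n (fun e => forall S, List.In S s -> S e).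
Proof.
elim: s => [|S s IH] h; first by apply: Def_ext (Def_not (Def_False n)) _ => e;
  split=> // _ [].
have hs S' : List.In S' s -> Def n S' by move=> ?; apply: h; right.
apply: Def_ext (Def_and (h S (or_introl erefl)) (IH hs)) _ => e.
split=> [[He H] S' [<-|/H]|H] //; split=> [|S' hS']; apply: H.
  by left.
by right.
Qed.

End Definability.

(** A change of language and a substitution performed together. Later uses add parameters to a
    language and replace the relations of $R$ by their definitions. *)
Lemma Def_transfer L1 L2 M (I1 : interp L1 M) (I2 : interp L2 M) n k
    (S : (nat -> M) -> Prop) (s : nat -> (nat -> M) -> M) :
  (forall f m (T : 'I_(far L1 f) -> (nat -> M) -> M), (forall i, Ter I2 m (T
    i)) ->
     Ter I2 m (fun e => fint I1 (f := f) [tuple T i e | i < far L1 f])) ->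
  (forall r m (T : 'I_(rar L1 r) -> (nat -> M) -> M), (forall i, Ter I2 m (T
    i)) ->
     Def I2 m (fun e => rint I1 (r := r) [tuple T i e | i < rar L1 r])) ->
  Def I1 k S -> (forall i, (i < k)%N -> Ter I2 n (s i)) ->
  Def I2 n (fun e => S (s^~ e)).
Proof.
move=> Hf Hr [phi Hphi] hs.
have /choice[us Hus] (i : 'I_k) : Ter I2 n (s i) by apply: hs.
(* Tuples are traced back to infinite assignments because [Ter] and [Def] speak of these. *)
pose P (x : unit) m (v : m.-tuple M) := exists e, v = etup m e.
have [] := @formula_translation L1 L2 unit (fun=> M) (fun=> I1) (fun=> I2) P
  _ _ _ k phi n us.
- by move=> x m y v [e ->]; exists (y .: e); rewrite etup_cons.
- move=> f m ts; have [|u Hu] := Hf f m (fun i e => teval I2 (etup m e) (ts i)).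
    by move=> i; exists (ts i).
  by exists u => _ v [e ->].
- move=> r m ts; have [|u Hu] := Hr r m (fun i e => teval I2 (etup m e) (ts i)).
    by move=> i; exists (ts i).
  by exists u => _ v [e ->].
move=> psi Hpsi; exists psi => e; rewrite (Hpsi tt); last by exists e.
rewrite -Hphi (_ : [tuple _ | i < k] = etup k (s^~ e)) //.
by apply: eq_from_tnth => i; rewrite !tnth_mktuple Hus.
Qed.

Lemma Def_subst L M (I : interp L M) n k (S : (nat -> M) -> Prop)
    (s : nat -> (nat -> M) -> M) :
  Def I k S -> (forall i, (i < k)%N -> Ter I n (s i)) ->
  Def I n (fun e => S (s^~ e)).
Proof.
apply: Def_transfer => [f m T|r m T /choice[us Hus]]; first exact: Ter_app.
exists (Rel us) => e /=.
rewrite (_ : [tuple _ | i < _] = [tuple T i e | i < rar L r]) //.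
by apply: eq_from_tnth => i; rewrite !tnth_mktuple Hus.
Qed.

Lemma Def_subst2 L M (I : interp L M) n S T1 T2 z : Def I 2 S ->
  Ter I n T1 -> Ter I n T2 -> Def I n (fun e => S (T1 e .: T2 e .: z)).
Proof.
move=> hS h1 h2; have := Def_subst (n := n)
  (s := fun i e => (T1 e .: T2 e .: z) i) hS.
by apply=> -[|[|i]].
Qed.

(** The Tarski-Vaught test. Applied to $y=f(v)$, the hypothesis closes $K$ under the functions, so
    the substructure is constructed rather than assumed. *)
Lemma tarski_vaught L M (J : interp L M) (K : M -> Prop) :
  (forall n (phi : formula L n.+1) (v : n.-tuple M),
     (forall i, K (tnth v i)) -> (exists y, sat J phi [tuple of y :: v]) ->
     exists2 y, K y & sat J phi [tuple of y :: v]) ->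
  exists I : interp L {x | K x}, forall n (phi : formula L n) v,
    sat I phi v <-> sat J phi (map_tuple sval v).
Proof.
move=> TV.
have Kt n (v : n.-tuple {x | K x}) i : K (tnth (map_tuple sval v) i).
  by rewrite tnth_map; apply: svalP.
have Kfun f (v : (far L f).-tuple {x | K x}) :
    K (fint J (f := f) (map_tuple sval v)).
  pose u := App (fun i : 'I_(far L f) => Var L i).
  have Eu w : teval J w u = fint J (f := f) w.
    by congr fint; apply: eq_from_tnth => i; rewrite tnth_mktuple.
  have HE y (w : (far L f).-tuple M) : sat J (Eq (Var L ord0) (tshift u))
    [tuple of y :: w] <->
                y = fint J (f := f) w.
    change (tnth [tuple of y :: w] ord0 = teval J [tuple of y :: w] (tshift u)
      <->
            y = fint J (f := f) w).
    by rewrite teval_tshift Eu tnth0.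
  have [|y Ky] := TV _ (Eq (Var L ord0) (tshift u)) _ (Kt _ v).
    by exists (fint J (f := f) (map_tuple sval v)); apply/HE.
  by move=> /HE <-.
pose I := @Interp L {x | K x} (fun f v => exist K _ (Kfun f v))
  (fun r v => rint J (r := r) (map_tuple sval v)).
have HT n (v : n.-tuple {x | K x}) u :
    sval (teval I v u) = teval J (map_tuple sval v) u.
  elim: u => [i|f args IH] /=; first by rewrite tnth_map.
  by congr fint; apply: eq_from_tnth => i; rewrite tnth_map !tnth_mktuple.
exists I => n phi; elim: n / phi => [n|n u1 u2|n r args|n p IHp q IHq|n p IHp]
  v //=.
- by rewrite -!HT; split=> [->|/eq_sig_hprop->].
- rewrite (_ : map_tuple _ _ = [tuple teval J (map_tuple sval v) (args i)
    | i < rar L r]) //.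
  by apply: eq_from_tnth => i; rewrite tnth_map !tnth_mktuple HT.
- by rewrite IHp IHq.
have E x : map_tuple sval [tuple of x :: v] = [tuple of sval x :: map_tuple
  sval v].
  exact: val_inj.
split=> H y; last by apply/IHp; rewrite E.
(* A counterexample in $M$ is replaced by one in $K$, by the hypothesis for the negation of [p]. *)
apply: contrapT => Hy.
have [||z Kz /=] := TV _ (Imp p (Fls L _)) (map_tuple sval v).
- exact: Kt.
- by exists y.
by case; have /IHp := H (exist K z Kz); rewrite E.
Qed.

(** * Multivariate polynomials and the density of N[t] *)

Section MPolyExtra.
Variable R : comNzRingType.

Lemma mpoly_ring_ind n (P : {mpoly R[n]} -> Prop) :
  (forall c, P c%:MP) -> (forall i, P 'X_i) ->
  (forall p q, P p -> P q -> P (p + q)) ->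
  (forall p q, P p -> P q -> P (p * q)) -> forall p, P p.
Proof.
move=> PC PX PD PM; elim/mpolyind => [|c m p _ _ Pp]; first by rewrite -mpolyC0.
apply: (PD) => //; rewrite -mul_mpolyC; apply: (PM) => //.
rewrite mpolyXE_id; elim/big_ind: _ => [||i _];
  [by rewrite -mpolyC1|exact: PM|].
elim: (m i) => [|k IH]; first by rewrite expr0 -mpolyC1.
by rewrite exprS; apply: (PM).
Qed.

Lemma mpoly0_const (p : {mpoly R[0]}) : p = (p@_0)%:MP.
Proof.
apply/mpolyP => m; rewrite mcoeffC (_ : m = 0%MM) ?eqxx ?mulr1 //.
by apply/mnmP => -[].
Qed.

Local Notation widen := (widen_ord (leqnSn _)).

(** The inverse of [muni], which singles out the last indeterminate. For differential polynomials
    this one stands for the highest derivative. *)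
Definition muni_inv n (q : {poly {mpoly R[n]}}) : {mpoly R[n.+1]} :=
  (map_poly (@mwiden n R) q).['X_ord_max].

Lemma muni_invD n (p q : {poly {mpoly R[n]}}) : muni_inv (p + q) = muni_inv p +
  muni_inv q.
Proof. by rewrite /muni_inv rmorphD hornerD. Qed.

Lemma muni_invM n (p q : {poly {mpoly R[n]}}) : muni_inv (p * q) = muni_inv p *
  muni_inv q.
Proof. by rewrite /muni_inv rmorphM hornerM. Qed.

Lemma muni_invC n c : muni_inv c%:P = @mwiden n R c.
Proof. by rewrite /muni_inv map_polyC hornerC. Qed.

Lemma muni_invX n : muni_inv 'X = 'X_ord_max :> {mpoly R[n.+1]}.
Proof. by rewrite /muni_inv map_polyX hornerX. Qed.

Lemma ord_widenP n (i : 'I_n.+1) : i = ord_max \/ exists j : 'I_n, i = widen j.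
Proof.
have [lt|ge] := ltnP i n; last by left; apply: val_inj => /=; case: i ge => /=;
  lia.
by right; exists (Ordinal lt); apply: val_inj.
Qed.

Lemma muniXU_max n : muni 'X_ord_max = 'X :> {poly {mpoly R[n]}}.
Proof.
rewrite muniE msuppX big_seq1 mcoeffX eqxx scale1r mnm1E eqxx expr1.
rewrite (_ : [multinom _ | _ < _] = 0%MM) ?mpolyX0 ?scale1r //.
apply/mnmP => j; rewrite !mnmE -val_eqE /=.
by rewrite gtn_eqF.
Qed.

Lemma muniXU n (j : 'I_n) : muni 'X_(widen j) = ('X_j)%:P :> {poly {mpoly
  R[n]}}.
Proof.
rewrite muniE msuppX big_seq1 mcoeffX eqxx scale1r mnm1E -val_eqE /=.
rewrite ltn_eqF // expr0 -mul_polyC mulr1; congr ('X_[_])%:P.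
by apply/mnmP => k; rewrite !mnmE -!val_eqE.
Qed.

Lemma muniK n : cancel (@muni n R) (@muni_inv n).
Proof.
elim/mpoly_ring_ind => [c|i|p q IHp IHq|p q IHp IHq].
- by rewrite muniC muni_invC mwidenC.
- have [->|[j ->]] := ord_widenP i; first by rewrite muniXU_max muni_invX.
  by rewrite muniXU muni_invC mwidenX mnmwiden1.
- by rewrite muniD muni_invD; congr (_ + _).
- by rewrite muniM muni_invM; congr (_ * _).
Qed.

Lemma muni_mwiden n (p : {mpoly R[n]}) : muni (mwiden p) = p%:P.
Proof.
elim/mpoly_ring_ind: p => [c|i|p q IHp IHq|p q IHp IHq].
- by rewrite mwidenC muniC.
- by rewrite mwidenX mnmwiden1 muniXU.
- by rewrite mwidenD muniD IHp IHq polyCD.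
- by rewrite mwidenM muniM IHp IHq polyCM.
Qed.

Lemma muni_invK n : cancel (@muni_inv n) (@muni n R).
Proof.
elim/poly_ind => [|p c IH]; first by rewrite /muni_inv rmorph0 horner0 muni0.
by rewrite muni_invD muni_invM muni_invX muni_invC muniD muniM IH muniXU_max
  muni_mwiden.
Qed.

Lemma meval_mwiden n (v : 'I_n.+1 -> R) p :
  (mwiden p).@[v] = p.@[fun i => v (widen i)].
Proof.
elim/mpoly_ring_ind: p => [c|i|p q IHp IHq|p q IHp IHq].
- by rewrite mwidenC !mevalC.
- by rewrite mwidenX mnmwiden1 !mevalXU.
- by rewrite mwidenD !mevalD IHp IHq.
- by rewrite mwidenM !mevalM IHp IHq.
Qed.

Lemma meval_muni n (v : 'I_n.+1 -> R) p :
  p.@[v] = (map_poly (meval (fun i => v (widen i))) (muni p)).[v ord_max].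
Proof.
elim/mpoly_ring_ind: p => [c|i|p q IHp IHq|p q IHp IHq].
- by rewrite muniC map_polyC hornerC /= !mevalC.
- have [->|[j ->]] := ord_widenP i.
    by rewrite muniXU_max map_polyX hornerX mevalXU.
  by rewrite muniXU map_polyC hornerC /= !mevalXU.
- by rewrite mevalD IHp IHq muniD rmorphD hornerD.
- by rewrite mevalM IHp IHq muniM rmorphM hornerM.
Qed.

(** In contrapositive form, positive degree in the last indeterminate yields [has_order], as Blum's
    axioms require. *)
Lemma size_muni_const n (p : {mpoly R[n.+1]}) :
  (forall m, m \in msupp p -> m ord_max = 0%N) -> (size (muni p) <= 1)%N.
Proof.
move=> h; rewrite muniE big_seq; elim/big_ind: _ => [|q r hq hr|m hm].
- by rewrite size_poly0.
- by rewrite (leq_trans (size_polyD _ _)) // geq_max hq.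
by rewrite (h m hm) expr0 -mul_polyC mulr1 size_polyC leq_b1.
Qed.

End MPolyExtra.

Section MapMPoly.
Variables (A B : comNzRingType) (f : {rmorphism A -> B}).

Lemma map_mpoly_inj n : injective f -> injective (@map_mpoly n A B f).
Proof.
move=> fI p q /mpolyP E; apply/mpolyP => m; apply: fI.
by rewrite -!mcoeff_map_mpoly E.
Qed.

Lemma map_mwiden n (p : {mpoly A[n]}) :
  map_mpoly f (mwiden p) = mwiden (map_mpoly f p).
Proof.
elim/mpoly_ring_ind: p => [c|i|p q IHp IHq|p q IHp IHq].
- by rewrite mwidenC !map_mpolyC mwidenC.
- by rewrite mwidenX !map_mpolyX mwidenX.
- by rewrite mwidenD !rmorphD /= IHp IHq.
- by rewrite mwidenM !rmorphM /= IHp IHq.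
Qed.

End MapMPoly.

Section Density.
Variables (F : fieldType) (D : F -> F) (t : F).
Hypothesis char0 : [pchar F] =i pred0.
Hypothesis Dder : derivation +%R *%R D.
Hypothesis Dt : D t = 1.

Lemma derD x y : D (x + y) = D x + D y. Proof. exact: Dder.1. Qed.
Lemma derM x y : D (x * y) = x * D y + D x * y. Proof. exact: Dder.2. Qed.
Lemma der0 : D 0 = 0.
Proof. by apply: (addrI (D 0)); rewrite -derD !addr0. Qed.
Lemma derN x : D (- x) = - D x.
Proof. by apply: (addrI (D x)); rewrite -derD !subrr der0. Qed.
Lemma derB x y : D (x - y) = D x - D y. Proof. by rewrite derD derN. Qed.
Lemma der1 : D 1 = 0.
Proof.
by apply: (addrI (D 1)); rewrite -{1}[D 1]mul1r -{2}[D 1]mulr1 -derM mul1r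
  addr0.
Qed.
Lemma derV x : D x^-1 = - D x / x ^+ 2.
Proof.
have [->|x0] := eqVneq x 0; first by rewrite invr0 der0 oppr0 mul0r.
have: D (x * x^-1) = 0 by rewrite divff // der1.
rewrite derM => /eqP; rewrite addr_eq0 => /eqP E.
by apply: (mulfI x0); rewrite E; field.
Qed.

Lemma iter_derD k x y : iter k D (x + y) = iter k D x + iter k D y.
Proof. by elim: k => //= k ->; rewrite derD. Qed.
Lemma iter_derN k x : iter k D (- x) = - iter k D x.
Proof. by elim: k => //= k ->; rewrite derN. Qed.
Lemma iter_der0 k : iter k D 0 = 0.
Proof. by elim: k => //= k ->; rewrite der0. Qed.

Lemma natf_eq0 n : (n%:R == 0 :> F) = (n == 0%N).
Proof. by move/pcharf0P: char0 => ->. Qed.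

Lemma natf_inj : injective (fun n => n%:R : F).
Proof.
have le_inj i j : (i <= j)%N -> i%:R = j%:R :> F -> i = j.
  by move=> le /esym/eqP; rewrite -subr_eq0 -natrB // natf_eq0; lia.
move=> i j E.
by case/orP: (leq_total i j) => /le_inj ij; [exact: ij|exact/esym/ij].
Qed.

Lemma der_nat n : D n%:R = 0.
Proof. by elim: n => [|n IH];
  rewrite ?der0 // -addn1 natrD derD IH der1 addr0. Qed.

Lemma der_natM n x : D (n%:R * x) = n%:R * D x.
Proof. by rewrite derM der_nat mul0r addr0. Qed.

Lemma derXn n : D (t ^+ n) = n%:R * t ^+ n.-1.
Proof.
elim: n => [|n IH]; first by rewrite expr0 der1 mul0r.
rewrite exprS derM IH Dt mul1r mulrCA -natr1 mulrDl mul1r; congr (_ + _).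
by case: n {IH} => [|n]; rewrite ?mul0r //= -exprS.
Qed.

Lemma iter_derXn i j : iter j D (t ^+ i) = (i ^_ j)%:R * t ^+ (i - j).
Proof.
elim: j => [|j IH] /=; first by rewrite ffactn0 mul1r subn0.
by rewrite IH der_natM derXn mulrA -natrM ffactnSr subnS.
Qed.

(** Opposites are left out so that each element is the value of a closed term. *)
Inductive nat_t : F -> Prop :=
| nat_t0 : nat_t 0
| nat_t1 : nat_t 1
| nat_tt : nat_t t
| nat_tD x y : nat_t x -> nat_t y -> nat_t (x + y)
| nat_tM x y : nat_t x -> nat_t y -> nat_t (x * y).

Lemma nat_t_nat n : nat_t n%:R.
Proof.
by elim: n => [|n IH]; [exact: nat_t0|rewrite -addn1 natrD;
  apply: nat_tD IH nat_t1].
Qed.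

Lemma nat_t_der x : nat_t x -> nat_t (D x).
Proof.
elim=> {x} [||| x y _ hx _ hy|x y x0 hx y0 hy].
- by rewrite der0; apply: nat_t0.
- by rewrite der1; apply: nat_t0.
- by rewrite Dt; apply: nat_t1.
- by rewrite derD; apply: nat_tD.
- by rewrite derM; apply: nat_tD; apply: nat_tM.
Qed.

Lemma poly_nat_nonroot (p : {poly F}) : p != 0 -> exists n, p.[n%:R] != 0.
Proof.
move=> p0; apply: contrapT => /forallNP h.
have rootp : all (root p) [seq i%:R | i <- iota 0 (size p)].
  by apply/allP => x /mapP[i _ ->]; apply: contraT => /h.
suff: uniq [seq i%:R : F | i <- iota 0 (size p)] 
  by move/(max_poly_roots p0 rootp); rewrite size_map size_iota ltnn.
rewrite map_inj_uniq ?iota_uniq //; exact: natf_inj.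
Qed.

(** Values of the first variables are chosen so that the leading coefficient in the last one
    survives; the last value then avoids finitely many roots. *)
Lemma mpoly_nat_nonroot n (p : {mpoly F[n]}) : p != 0 ->
  exists r : 'I_n -> nat, p.@[fun i => (r i)%:R] != 0.
Proof.
elim: n p => [|n IH] p p0.
  exists (fun=> 0%N); apply: contra_neq p0.
  by rewrite (mpoly0_const p) mevalC => ->; rewrite mpolyC0.
have up0 : muni p != 0.
  by apply: contra_neq p0 => E; rewrite -[p]muniK E -(muni0 n F) muniK.
have [|r hr] := IH (lead_coef (muni p)); first by rewrite lead_coef_eq0.
pose q := map_poly (meval (fun i => (r i)%:R)) (muni p).
have [k hk] : exists k, q.[k%:R] != 0.
  apply: poly_nat_nonroot; apply: contra_neq hr => q0.
  by rewrite lead_coefE -(coef_map (meval (fun i => (r i)%:R))) -/q q0 coef0.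
exists (fun i => if insub (i : nat) is Some j then r j else k).
rewrite meval_muni /=; apply: contra_neq hk => <-.
rewrite insubF ?ltnn // /q; congr horner; apply: eq_map_poly => c.
by apply: meval_eq => i /=; rewrite insubT //= => h; congr (r _)%:R;
  apply: val_inj.
Qed.

(** The jet of $\sum_i r_i t^i$ is linear in $r$, with matrix $(\mathrm D^j t^i)$. This matrix is
    triangular with factorials on its diagonal, hence invertible in characteristic 0, and [P] pulls
    back to a nonzero polynomial in $r$. *)
Lemma nat_t_dense n (P : {mpoly F[n]}) : P != 0 ->
  exists2 r, nat_t r & dpeval D P r != 0.
Proof.
move=> P0; have [p hp] := mpoly_nat_nonroot P0.
pose L := \matrix_(i < n, j < n) iter j D (t ^+ i).
have uL : L \in unitmx.
  rewrite unitmxE det_trig; last first.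
    by apply/is_trig_mxP => i j lt; rewrite mxE iter_derXn ffact_small // mul0r.
  rewrite unitfE; apply/prodf_neq0 => i _.
  by rewrite mxE iter_derXn ffactnn subnn mulr1 natf_eq0 -lt0n fact_gt0.
pose Q := P \mPo [tuple \sum_(i < n) L i j *: 'X_i | j < n].
have HQ (v : 'I_n -> F) : Q.@[v] = P.@[fun j => \sum_i v i * L i j].
  rewrite comp_mpoly_meval; apply: meval_eq => j.
  rewrite tnth_mktuple rmorph_sum /=; apply: eq_bigr => i _.
  by rewrite mevalZ mevalXU mulrC.
(* The preimage of a point where [P] does not vanish; it shows that [Q] is nonzero. *)
pose v0 : 'rV[F]_n := (\row_j (p j)%:R) *m invmx L.
have Q0 : Q != 0.
  apply: contra_neq hp => Q0; have := HQ (v0 0); rewrite Q0 meval0 => ->.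
  apply: meval_eq => j; have :=
    congr1 (fun M : 'rV_n => M 0 j) (mulmxKV uL (\row_j (p j)%:R)).
  by rewrite !mxE.
have [r hr] := mpoly_nat_nonroot Q0.
exists (\sum_(i < n) (r i)%:R * t ^+ i).
  elim/big_ind: _ => [|x y|i _]; [exact: nat_t0|exact: nat_tD|].
  apply: nat_tM (nat_t_nat _) _; elim: (i : nat) => [|k]; first exact: nat_t1.
  by rewrite exprS; apply: nat_tM; apply: nat_tt.
apply: contra_neq hr => <-; rewrite HQ; apply: meval_eq => j.
have itS (I : seq 'I_n) (G : 'I_n -> F) :
    iter j D (\sum_(i <- I) G i) = \sum_(i <- I) iter j D (G i).
  by elim: I => [|i I IH]; rewrite ?big_nil ?iter_der0 // !big_cons iter_derD
    IH.
rewrite itS; apply: eq_bigr => i _; rewrite mxE.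
by elim: (j : nat) => //= k <-; rewrite der_natM.
Qed.

End Density.

(** * Differential polynomials as differences of terms *)

Section RingTerms.
Variables (F : fieldType) (t : F) (L : language) (I : interp L F).
Local Notation J := (isum (i_t t) I).

(** The second summand [I] of the language is arbitrary, so that these lemmas serve both the
    differential field and $\mathcal F_R$. *)
Lemma Ter_add n T1 T2 :
  Ter J n T1 -> Ter J n T2 -> Ter J n (fun e => T1 e + T2 e).
Proof.
move=> h1 h2; apply: Ter_ext (@Ter_app _ _ J n (inl (inl RAdd))
  (fun i : 'I_2 => if i == ord0 then T1 else T2) _) _ => [i|e] /=.
  by case: ifP.
by rewrite !tnth_mktuple.
Qed.

Lemma Ter_mul n T1 T2 :
  Ter J n T1 -> Ter J n T2 -> Ter J n (fun e => T1 e * T2 e).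
Proof.
move=> h1 h2; apply: Ter_ext (@Ter_app _ _ J n (inl (inl RMul))
  (fun i : 'I_2 => if i == ord0 then T1 else T2) _) _ => [i|e] /=.
  by case: ifP.
by rewrite !tnth_mktuple.
Qed.

Lemma Ter_0 n : Ter J n (fun=> 0).
Proof. by apply: Ter_ext (@Ter_app _ _ J n (inl (inl RZero)) (fun _ _ => 0) _)
  _ => [[]|]. Qed.

Lemma Ter_1 n : Ter J n (fun=> 1).
Proof. by apply: Ter_ext (@Ter_app _ _ J n (inl (inl ROne)) (fun _ _ => 0) _) _
  => [[]|]. Qed.

Lemma Ter_t n : Ter J n (fun=> t).
Proof. by apply: Ter_ext (@Ter_app _ _ J n (inl (inr tt)) (fun _ _ => 0) _) _
  => [[]|]. Qed.

Lemma Ter_nat_t n x : nat_t t x -> Ter J n (fun=> x).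
Proof.
elim=> [|||y z _ hy _ hz|y z _ hy _ hz].
- exact: Ter_0.
- exact: Ter_1.
- exact: Ter_t.
- exact: Ter_add.
- exact: Ter_mul.
Qed.

End RingTerms.

Section DiffTerms.
Variables (F : fieldType) (D : F -> F) (t : F).
Hypothesis char0 : [pchar F] =i pred0.
Hypothesis Dder : derivation +%R *%R D.
Hypothesis Dt : D t = 1.

Local Notation I := (i_tD D t).
Implicit Types (n : nat) (e : nat -> F) (T : (nat -> F) -> F).

Lemma Ter_der n T : Ter I n T -> Ter I n (fun e => D (T e)).
Proof.
move=> h; apply: Ter_ext (@Ter_app _ _ I n (inr tt) (fun _ => T) _) _ => [i|e]
  //=.
by rewrite /thead tnth_mktuple.
Qed.

Lemma Ter_ind n (Q : ((nat -> F) -> F) -> Prop) :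
  (forall i, (i < n)%N -> Q (fun e => e i)) ->
  Q (fun=> 0) -> Q (fun=> 1) -> Q (fun=> t) ->
  (forall T1 T2, Q T1 -> Q T2 -> Q (fun e => T1 e + T2 e)) ->
  (forall T1 T2, Q T1 -> Q T2 -> Q (fun e => T1 e * T2 e)) ->
  (forall T, Q T -> Q (fun e => D (T e))) ->
  forall T, Ter I n T -> Q T.
Proof.
move=> Qv Q0 Q1 Qt QD QM Qder T [u /funext <-].
elim: u => [i|f args IH].
  rewrite (_ : (fun e => _) = (fun e => e i)); first exact: Qv.
  by apply/funext => e /=; rewrite tnth_mktuple.
case: f args IH => [[[]|[]]|[]] /= args IH //.
- set i0 : 'I_2 := ord0; set i1 : 'I_2 := ord_max.
  have := QD _ _ (IH i0) (IH i1); congr Q.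
  by apply/funext => e; rewrite !tnth_mktuple.
- set i0 : 'I_2 := ord0; set i1 : 'I_2 := ord_max.
  have := QM _ _ (IH i0) (IH i1); congr Q.
  by apply/funext => e; rewrite !tnth_mktuple.
- have := Qder _ (IH (ord0 : 'I_1)); congr Q.
  by apply/funext => e; rewrite /thead !tnth_mktuple.
Qed.

(* Subtraction is not in the language: differential polynomials with integer
   coefficients are differences of terms. *)
Definition DT n T :=
  exists T1 T2, [/\ Ter I n T1, Ter I n T2 & forall e, T e = T1 e - T2 e].

Lemma DT_ext n T T' : DT n T -> T =1 T' -> DT n T'.
Proof. by move=> [T1 [T2 [? ? E]]] E'; exists T1, T2; split=> // e;
  rewrite -E'. Qed.

Lemma DT_Ter n T : Ter I n T -> DT n T.
Proof.
by move=> h; exists T, (fun=> 0); split=> //; [exact: Ter_0|move=> e;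
  rewrite subr0].
Qed.

Lemma DT_opp n T : DT n T -> DT n (fun e => - T e).
Proof.
by move=> [T1 [T2 [? ? E]]]; exists T2, T1; split=> // e; rewrite E opprB.
Qed.

Lemma DT_add n T T' : DT n T -> DT n T' -> DT n (fun e => T e + T' e).
Proof.
move=> [T1 [T2 [h1 h2 E]]] [T3 [T4 [h3 h4 E']]].
exists (fun e => T1 e + T3 e), (fun e => T2 e + T4 e).
by split=> [||e]; [exact: Ter_add|exact: Ter_add|rewrite E E'; ring].
Qed.

Lemma DT_sub n T T' : DT n T -> DT n T' -> DT n (fun e => T e - T' e).
Proof. by move=> h h'; apply: DT_add h (DT_opp h'). Qed.

Lemma DT_mul n T T' : DT n T -> DT n T' -> DT n (fun e => T e * T' e).
Proof.
move=> [T1 [T2 [h1 h2 E]]] [T3 [T4 [h3 h4 E']]].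
exists (fun e => T1 e * T3 e + T2 e * T4 e), (fun e => T1 e * T4 e + T2 e * T3
  e).
split=> [||e]; last by rewrite E E'; ring.
- by apply: Ter_add; apply: Ter_mul.
- by apply: Ter_add; apply: Ter_mul.
Qed.

Lemma DT_der n T : DT n T -> DT n (fun e => D (T e)).
Proof.
move=> [T1 [T2 [h1 h2 E]]]; exists (fun e => D (T1 e)), (fun e => D (T2 e)).
by split=> [||e]; [exact: Ter_der|exact: Ter_der|rewrite E derB].
Qed.

Lemma DT_iter n k T : DT n T -> DT n (fun e => iter k D (T e)).
Proof. by move=> h; elim: k => //= k; apply: DT_der. Qed.

Lemma DT_var n i : (i < n)%N -> DT n (fun e => e i).
Proof. by move=> h; apply/DT_Ter/Ter_var. Qed.

Lemma Ter_DT_subst k n T (s : nat -> (nat -> F) -> F) : Ter I k T ->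
  (forall i, (i < k)%N -> DT n (s i)) -> DT n (fun e => T (s^~ e)).
Proof.
move=> hT hs; elim/Ter_ind: T / hT => //.
- exact/DT_Ter/Ter_0.
- exact/DT_Ter/Ter_1.
- exact/DT_Ter/Ter_t.
- by move=> T1 T2; apply: DT_add.
- by move=> T1 T2; apply: DT_mul.
- by move=> T; apply: DT_der.
Qed.

Lemma DT_subst k n T (s : nat -> (nat -> F) -> F) : DT k T ->
  (forall i, (i < k)%N -> DT n (s i)) -> DT n (fun e => T (s^~ e)).
Proof.
move=> [T1 [T2 [h1 h2 E]]] hs.
apply: DT_ext (DT_sub (Ter_DT_subst h1 hs) (Ter_DT_subst h2 hs)) _ => e.
by rewrite E.
Qed.

(* The values at [e] and [e'] of the same differential polynomials.  When [e]
   and [e'] satisfy the same differential equations, this is the graph of an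
   isomorphism between the differential rings that they generate. *)
Section PairRing.
Variables (n : nat) (e e' : nat -> F).

Definition pair_pred : {pred F * F} :=
  fun x => `[< exists2 T, DT n T & x = (T e, T e') >].

Lemma pair_subring : subring_closed pair_pred.
Proof.
split=> [|_ _ /asboolP[T hT ->] /asboolP[T' hT' ->]
         |_ _ /asboolP[T hT ->] /asboolP[T' hT' ->]].
- by apply/asboolP; exists (fun=> 1) => //; apply/DT_Ter/Ter_1.
- by apply/asboolP; exists (fun z => T z - T' z) => //; apply/DT_sub.
- by apply/asboolP; exists (fun e => T e * T' e) => //; apply/DT_mul.
Qed.

HB.instance Definition _ :=
  GRing.isSubringClosed.Build (F * F)%type pair_pred pair_subring.

Record pair_ring := PairRing { pair_val : F * F; _ : pair_val \in pair_pred }.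
HB.instance Definition _ := [isSub for pair_val].
HB.instance Definition _ := [Choice of pair_ring by <:].
HB.instance Definition _ := [SubChoice_isSubComNzRing of pair_ring by <:].

Definition pair1 : {rmorphism pair_ring -> F} :=
  fst \o (val : pair_ring -> F * F).
Definition pair2 : {rmorphism pair_ring -> F} :=
  snd \o (val : pair_ring -> F * F).

Lemma pair_of T : DT n T -> exists2 a, pair1 a = T e & pair2 a = T e'.
Proof.
move=> hT; have h : (T e, T e') \in pair_pred by apply/asboolP; exists T.
by exists (PairRing h).
Qed.

Lemma pair_DT a : exists2 T, DT n T & pair1 a = T e /\ pair2 a = T e'.
Proof. by case: a => x /[dup] /asboolP[T hT Ex] h; exists T;
  rewrite // /pair1 /pair2 /= Ex. Qed.

Lemma pair_der a : exists2 b, pair1 b = D (pair1 a) & pair2 b = D (pair2 a).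
Proof. by have [T hT [-> ->]] := pair_DT a; apply: pair_of (DT_der hT). Qed.

(** Equality of quantifier-free types; back and forth will make it equality of types. *)
Definition eqv := forall T, DT n T -> (T e == 0) = (T e' == 0).

Lemma pair_eqP a b : pair1 a = pair1 b -> pair2 a = pair2 b -> a = b.
Proof.
move=> E1 E2; apply: val_inj; move: E1 E2; rewrite /pair1 /pair2 /=.
by case: (pair_val a) (pair_val b) => [? ?] [? ?] /= -> ->.
Qed.

Hypothesis eqv_ee' : eqv.

Lemma pair1_inj : injective pair1.
Proof.
move=> a b /eqP; rewrite -subr_eq0 -rmorphB => /eqP h.
have [T hT [E1 E2]] := pair_DT (a - b).
have z2 : pair2 (a - b) = 0 by apply/eqP; rewrite E2 -eqv_ee' // -E1 h.
by apply/eqP; rewrite -subr_eq0; apply/eqP/pair_eqP; rewrite ?h ?z2 rmorph0.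
Qed.

Lemma pair2_inj : injective pair2.
Proof.
move=> a b /eqP; rewrite -subr_eq0 -rmorphB => /eqP h.
have [T hT [E1 E2]] := pair_DT (a - b).
have z1 : pair1 (a - b) = 0 by apply/eqP; rewrite E1 eqv_ee' // -E2 h.
by apply/eqP; rewrite -subr_eq0; apply/eqP/pair_eqP; rewrite ?h ?z1 rmorph0.
Qed.

End PairRing.

End DiffTerms.

(** * Algebraic dependence *)

Section AlgebraicDependence.
Variables (A : comNzRingType) (F : fieldType) (f : {rmorphism A -> F}).
Hypothesis f_inj : injective f.

(** Embedding into a field makes [A] a domain; this is the form in which rings such as [pair_ring]
    are known to be domains. *)
Lemma inj_rmorph_mulf_eq0 (x y : A) : x * y = 0 -> x <> 0 -> y = 0.
Proof.
move=> xy x0; apply: f_inj; rewrite rmorph0; apply/eqP.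
have /eqP := congr1 f xy; rewrite rmorphM rmorph0 mulf_eq0 => /orP[/eqP h|//].
by case: x0; apply: f_inj; rewrite h rmorph0.
Qed.

(* Fraction-free elimination, as [A] is not a field. *)
Lemma left_kernel m n (M : 'M[A]_(m, n)) : (n < m)%N ->
  exists2 a : 'rV[A]_m, a <> 0 & a *m M = 0.
Proof.
elim: n m M => [|n IH] [|m] M // lt.
  exists (const_mx 1); last exact: thinmx0.
  by move=> /matrixP/(_ 0 0)/eqP; rewrite !mxE oner_eq0.
have [[p p0]|/forallNP h] := pselect (exists p, M p 0 <> 0); last first.
  have [|a a0 aM] := IH m.+1 (\matrix_(i, j) M i (lift 0 j)); first by lia.
  exists a => //; apply/matrixP => i j; rewrite !mxE.
  case: (unliftP 0 j) => [k|] ->; last first.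
    by rewrite big1 // => k _; have /contrapT -> := h k; rewrite mulr0.
  have /matrixP/(_ i k) := aM; rewrite !mxE; apply: etrans.
  by apply: eq_bigr => l _; rewrite mxE.
(* The pivot row [p] clears the first column of the other rows by cross-multiplication. *)
pose M' := \matrix_(j < m, k < n)
  (M p 0 * M (lift p j) (lift 0 k) - M (lift p j) 0 * M p (lift 0 k)).
have [|a a0 aM] := IH m M'; first by lia.
(* A relation among the rows of [M'] is scaled by the pivot; the coefficient of row [p] is the one
   that cancels the first column. *)
exists (\row_i if unlift p i is Some j then M p 0 * a 0 j
               else - \sum_j a 0 j * M (lift p j) 0).
  move=> /matrixP E; apply: a0; apply/matrixP => i j; rewrite ord1 mxE.
  have := E 0 (lift p j); rewrite !mxE liftK => /inj_rmorph_mulf_eq0; exact.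
apply/matrixP => i c; rewrite ord1 !mxE (bigD1_ord p) //= mxE unlift_none.
under [X in _ + X]eq_bigr => j _ do rewrite mxE liftK.
rewrite mulNr mulr_suml -sumrN -big_split /=.
case: (unliftP 0 c) => [k|] ->; last by rewrite big1 // => j _; ring.
have /matrixP/(_ 0 k) := aM; rewrite !mxE; apply: etrans.
by apply: eq_bigr => j _; rewrite mxE; ring.
Qed.

Definition deg_le n k (p : {mpoly A[n]}) :=
  forall m, m \in msupp p -> (mdeg m <= k)%N.

Lemma deg_leM n k l (p q : {mpoly A[n]}) :
  deg_le k p -> deg_le l q -> deg_le (k + l) (p * q).
Proof.
move=> hp hq m /msuppM_le /allpairsP[[m1 m2] /= [h1 h2 ->]].
by rewrite mdegD leq_add ?hp ?hq.
Qed.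

Lemma deg_leX n k l (p : {mpoly A[n]}) : deg_le k p -> deg_le (k * l) (p ^+ l).
Proof.
move=> hp; elim: l => [|l IH]; last by rewrite exprS mulnS; apply: deg_leM.
by move=> m; rewrite expr0 msupp1 inE => /eqP->; rewrite mdeg0.
Qed.

Lemma deg_le_prod n (I : finType) k (p : I -> {mpoly A[n]}) :
  (forall i, deg_le k (p i)) -> deg_le (#|I| * k) (\prod_i p i).
Proof.
move=> hp; rewrite -sum_nat_const.
rewrite (_ : \sum_(i in I) k = \sum_(i : I) k)%N //.
elim/big_ind2: _ => [|k1 p1 k2 p2|i _] //; last exact: deg_leM.
by move=> m; rewrite msupp1 inE => /eqP->; rewrite mdeg0.
Qed.

Lemma deg_le_bound n (I : finType) (p : I -> {mpoly A[n]}) :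
  exists k, forall i, deg_le k (p i).
Proof.
exists (\max_i msize (p i)) => i m /msize_mdeg_lt lt.
by apply: leq_trans (ltnW lt) (leq_bigmax i).
Qed.

Lemma card_bmultinom n k : (#|{: 'X_{1..n < k}}| <= k ^ n)%N.
Proof.
have lt (m : 'X_{1..n < k}) i : (bmnm m i < k)%N.
  apply: leq_ltn_trans (bmdeg m); rewrite mdegE (bigD1 i) //=; exact: leq_addr.
pose g (m : 'X_{1..n < k}) := [ffun i => Ordinal (lt m i)].
have gI : injective g.
  move=> m1 m2 /ffunP E; apply: val_inj; apply/mnmP => i.
  by have /(congr1 val) := E i; rewrite !ffunE.
by have := leq_card g gI; rewrite card_ffun !card_ord.
Qed.

(* Counting: the s^(n+1) monomials of degree < s in each of n+1 rational
   functions of n variables live in a space of dimension O(s^n). *)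
Lemma algebraic_dependence n (P Q : 'I_n.+1 -> {mpoly A[n]}) (b : 'I_n -> F) :
  (forall i, (map_mpoly f (Q i)).@[b] != 0) ->
  exists2 p : {mpoly A[n.+1]}, p != 0 &
    (map_mpoly f p).@[fun i =>
      (map_mpoly f (P i)).@[b] / (map_mpoly f (Q i)).@[b]] = 0.
Proof.
move=> Q0; have [dP hP] := deg_le_bound P; have [dQ hQ] := deg_le_bound Q.
pose d := maxn dP dQ.
have hPd i : deg_le d (P i) by move=> m /hP h; rewrite leq_max h.
have hQd i : deg_le d (Q i) by move=> m /hQ h; rewrite leq_max h orbT.
(* Each [R u] below has degree at most $(n+1)ds<Cs=k$. There are at most $k^n=C^ns^n$ monomials of
   degree less than $k$, which is less than the number $s^{n+1}$ of exponents [u] since $s>C^n$. *)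
pose C := (n.+1 * d).+1; pose s := (C ^ n).+1; pose k := (C * s)%N.
pose E := {ffun 'I_n.+1 -> 'I_s}.
(* The monomial with exponents [u] in the fractions $P_i/Q_i$, multiplied by the common denominator
   $\prod_i Q_i^s$. *)
pose R (u : E) := \prod_i (P i ^+ u i * Q i ^+ (s - u i)).
have hR u m : m \in msupp (R u) -> (mdeg m < k)%N.
  have h i : deg_le (d * s) (P i ^+ u i * Q i ^+ (s - u i)).
    rewrite (_ : d * s = d * u i + d * (s - u i))%N.
      by apply: deg_leM; apply: deg_leX.
    by rewrite -mulnDr subnKC // ltnW.
  move=> /(deg_le_prod h); rewrite card_ord => /leq_ltn_trans; apply.
  by rewrite /k /C /s; nia.
have cardE : (#|{: 'X_{1..n < k}}| < #|E|)%N.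
  apply: leq_ltn_trans (card_bmultinom _ _) _.
  by rewrite card_ffun !card_ord expnMn expnS ltn_pmul2r // expn_gt0.
(* Row [u] lists the coefficients of [R u], so the left kernel consists of the linear relations
   among the [R u]. Such a relation is the polynomial [p]. *)
pose M := \matrix_(i < #|E|, j < #|{: 'X_{1..n < k}}|)
  (R (enum_val i))@_(enum_val j).
have [a a0 aM] := left_kernel M cardE.
pose mon (u : E) : 'X_{1..n.+1} := [multinom (u i : nat) | i < n.+1].
have monI : injective mon.
  move=> u v /mnmP h; apply/ffunP => i; apply: val_inj.
  by have := h i; rewrite !mnmE.
pose p := \sum_(u : E) a 0 (enum_rank u) *: 'X_[mon u].
exists p.
  apply/eqP => p0; apply: a0; apply/matrixP => i j; rewrite ord1 !mxE.
  have := congr1 (fun q => q@_(mon (enum_val j))) p0.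
  rewrite mcoeff0 raddf_sum /= (bigD1 (enum_val j)) //= big1 => [|u ne].
    by rewrite mcoeffZ mcoeffX eqxx mulr1 addr0 enum_valK.
  by rewrite mcoeffZ mcoeffX (inj_eq monI) (negbTE ne) mulr0.
have aR : \sum_(u : E) a 0 (enum_rank u) *: R u = 0.
  apply/mpolyP => m; rewrite mcoeff0 raddf_sum /=.
  have [lt|ge] := ltnP (mdeg m) k; last first.
    rewrite big1 // => u _; rewrite mcoeffZ memN_msupp_eq0 ?mulr0 //.
    by apply/negP => /hR; lia.
  have /matrixP/(_ 0 (enum_rank (BMultinom lt))) := aM; rewrite !mxE.
  apply: etrans.
  rewrite (reindex enum_rank) /=; last exact: onW_bij (enum_rank_bij _).
  by apply: eq_bigr => u _; rewrite mcoeffZ mxE !enum_rankK.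
pose bev q := (map_mpoly f q).@[b].
pose q := \prod_i bev (Q i) ^+ s.
have q0 : q != 0 by apply/prodf_neq0 => i _; rewrite expf_neq0 // Q0.
apply: (mulfI q0); rewrite mulr0; have := congr1 bev aR.
have evS l (v : 'I_l -> F) (G : E -> {mpoly A[l]}) :
    (map_mpoly f (\sum_u G u)).@[v] = \sum_u (map_mpoly f (G u)).@[v].
  exact: (raddf_sum (meval v \o map_mpoly f)).
rewrite /bev !rmorph0; apply: etrans; rewrite /p !evS mulr_sumr.
apply: eq_bigr => u _; rewrite map_mpolyZ map_mpolyX mevalZ mevalX.
rewrite -mul_mpolyC rmorphM /= map_mpolyC mevalM mevalC mulrCA; congr (_ * _).
rewrite /q -big_split /= !rmorph_prod /=; apply: eq_bigr => i _.
rewrite mnmE !rmorphM /= !rmorphXn /= -/(bev _) -/(bev _).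
have le : (u i <= s)%N by rewrite ltnW.
have := Q0 i; rewrite -/(bev _) => Qi0.
rewrite expr_div_n -{1}(subnK le) exprD; field.
by rewrite expf_neq0.
Qed.

End AlgebraicDependence.

(** * Differentially algebraic elements *)

Section DiffPoly.
Variables (F : fieldType) (D : F -> F) (t : F).
Hypothesis char0 : [pchar F] =i pred0.
Hypothesis Dder : derivation +%R *%R D.
Hypothesis Dt : D t = 1.
Local Notation I := (i_tD D t).
Implicit Types (n : nat) (e : nat -> F) (T : (nat -> F) -> F).

Section Dev.
Variables (A : comNzRingType) (f : {rmorphism A -> F}).

(** Coefficients lie in an abstract ring so that one differential polynomial can be evaluated
    through two embeddings in [F]. *)
Definition dev N (y : F) (P : {mpoly A[N]}) : F := dpeval D (map_mpoly f P) y.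

HB.instance Definition _ N y := GRing.RMorphism.copy (@dev N y)
  (meval (fun i : 'I_N => iter i D y) \o map_mpoly f).

Lemma devC N y c : dev y (c%:MP_[N]) = f c.
Proof. by rewrite /dev /dpeval map_mpolyC mevalC. Qed.

Lemma devX N y i : dev y ('X_i : {mpoly A[N]}) = iter i D y.
Proof. by rewrite /dev /dpeval map_mpolyX mevalXU. Qed.

Lemma dev_mwiden N y (P : {mpoly A[N]}) : dev y (mwiden P) = dev y P.
Proof. by rewrite /dev /dpeval map_mwiden meval_mwiden. Qed.

Lemma dev_widen N N' (P : {mpoly A[N]}) : (N <= N')%N ->
  exists P' : {mpoly A[N']}, forall y, dev y P' = dev y P.
Proof.
elim: N' => [|N' IH].
  by rewrite leqn0 => /eqP E; subst N; exists P.
rewrite leq_eqVlt => /orP[/eqP <-|/IH[P' HP']]; first by exists P.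
by exists (mwiden P') => y; rewrite dev_mwiden.
Qed.

Lemma dev_common_order N1 N2 (P1 : {mpoly A[N1]}) (P2 : {mpoly A[N2]}) :
  exists N (Q1 Q2 : {mpoly A[N]}),
    forall y, dev y Q1 = dev y P1 /\ dev y Q2 = dev y P2.
Proof.
have [Q1 H1] := dev_widen P1 (leq_maxl N1 N2).
have [Q2 H2] := dev_widen P2 (leq_maxr N1 N2).
by exists (maxn N1 N2), Q1, Q2.
Qed.

Hypothesis f_der : forall a, exists b, f b = D (f a).

Lemma dev_der N (P : {mpoly A[N]}) :
  exists P' : {mpoly A[N.+1]}, forall y, D (dev y P) = dev y P'.
Proof.
elim/mpoly_ring_ind: P => [c|i|p q [p' Hp] [q' Hq]|p q [p' Hp] [q' Hq]].
- by have [b Hb] := f_der c; exists b%:MP => y; rewrite !devC Hb.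
- by exists 'X_(lift ord0 i) => y; rewrite !devX.
- by exists (p' + q') => y; rewrite !rmorphD /= derD // Hp Hq.
- exists (mwiden p * q' + p' * mwiden q) => y.
  by rewrite !(rmorphD, rmorphM) /= derM // !dev_mwiden Hp Hq.
Qed.

Lemma Ter_dev n e T :
  (forall i, (i < n)%N -> exists a, f a = e i) -> (exists a, f a = t) ->
  Ter I n.+1 T ->
  exists N (P : {mpoly A[N]}), forall y, T (y .: e) = dev y P.
Proof.
move=> fe [at' Et] hT; elim/(@Ter_ind F D t): T / hT.
- case=> [|i] lt; first by exists 1%N, 'X_ord0 => y; rewrite devX.
  by have [a Ea] := fe i lt; exists 0%N, a%:MP => y; rewrite devC Ea.
- by exists 0%N, 0 => y; rewrite rmorph0.
- by exists 0%N, 1 => y; rewrite rmorph1.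
- by exists 0%N, at'%:MP => y; rewrite devC Et.
- move=> T1 T2 [N1 [P1 H1]] [N2 [P2 H2]].
  have [N [Q1 [Q2 H]]] := dev_common_order P1 P2.
  by exists N, (Q1 + Q2) => y;
    rewrite rmorphD /= H1 H2 !(proj1 (H y)) (proj2 (H y)).
- move=> T1 T2 [N1 [P1 H1]] [N2 [P2 H2]].
  have [N [Q1 [Q2 H]]] := dev_common_order P1 P2.
  by exists N, (Q1 * Q2) => y;
    rewrite rmorphM /= H1 H2 !(proj1 (H y)) (proj2 (H y)).
- move=> T1 [N [P H]]; have [P' H'] := dev_der P.
  by exists N.+1, P' => y; rewrite H H'.
Qed.

Lemma DT_dev n e T :
  (forall i, (i < n)%N -> exists a, f a = e i) -> (exists a, f a = t) ->
  DT D t n.+1 T ->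
  exists N (P : {mpoly A[N]}), forall y, T (y .: e) = dev y P.
Proof.
move=> fe ft [T1 [T2 [/(Ter_dev fe ft)[N1 [P1 H1]] /(Ter_dev fe ft)[N2 [P2 H2]]
  E]]].
have [N [Q1 [Q2 H]]] := dev_common_order P1 P2.
by exists N, (Q1 - Q2) => y;
  rewrite rmorphB /= E H1 H2 (proj1 (H y)) (proj2 (H y)).
Qed.

Lemma dev_dense N (P : {mpoly A[N]}) : injective f -> P != 0 ->
  exists2 r, nat_t t r & dev r P != 0.
Proof.
move=> fI P0; have [|r] := nat_t_dense char0 Dder Dt (P := map_mpoly f P).
  by apply: contra_neq P0 => E; apply: (map_mpoly_inj fI); rewrite E rmorph0.
by exists r.
Qed.

End Dev.

(** Nonvanishing of a differential polynomial can be stated through its values, because by density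
    these already detect it on $\mathbb N[t]$. *)
Definition nonzero e T := exists y, T (y .: e) != 0.

Lemma DT_mpoly n e T : DT D t n.+1 T ->
  exists N (P : {mpoly F[N]}), forall y, T (y .: e) = dev idfun y P.
Proof.
by apply: DT_dev => [a|i _|]; [exists (D a)|exists (e i)|exists t].
Qed.

Lemma nonzero_dense n e T : DT D t n.+1 T -> nonzero e T ->
  exists2 r, nat_t t r & T (r .: e) != 0.
Proof.
move=> /(DT_mpoly e)[N [P H]] [y]; rewrite H => Py.
have [//|| r hr Pr] := dev_dense (f := idfun) (P := P); last by exists r;
  rewrite ?H.
by apply: contra_neq Py => ->; rewrite rmorph0.
Qed.

(** The two factors may be nonzero at different points; their product is a nonzero polynomial, and
    density supplies a common point. *)
Lemma nonzeroM n e T T' : DT D t n.+1 T -> DT D t n.+1 T' ->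
  nonzero e T -> nonzero e T' -> nonzero e (fun e => T e * T' e).
Proof.
move=> /(DT_mpoly e)[N1 [P1 H1]] /(DT_mpoly e)[N2 [P2 H2]] [y1 h1] [y2 h2].
have [N [Q1 [Q2 H]]] := dev_common_order idfun P1 P2.
have [//||r _] := dev_dense (f := idfun) (P := Q1 * Q2).
  rewrite mulf_neq0 //; [move: h1|move: h2]; apply: contra_neq => E.
    by rewrite H1 -(proj1 (H y1)) E rmorph0.
  by rewrite H2 -(proj2 (H y2)) E rmorph0.
rewrite rmorphM /= (proj1 (H r)) (proj2 (H r)) -H1 -H2 => hr; exists r.
exact: hr.
Qed.

(** A coefficient in [pair_ring] is the pair of values of a single expression, which is why one [T]
    serves both tuples. *)
Lemma dev_DT n e e' N (P : {mpoly pair_ring D t n e e'[N]}) :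
  exists2 T, DT D t n.+1 T & forall y,
    T (y .: e) = dev (pair1 D t n e e') y P /\
    T (y .: e') = dev (pair2 D t n e e') y P.
Proof.
elim/mpoly_ring_ind: P => [c|i|p q [T hT E] [T' hT' E']|p q [T hT E] [T' hT'
  E']].
- have [T hT [E1 E2]] := pair_DT c.
  exists (fun e => T (fun i => e i.+1)).
    by apply: DT_subst hT _ => // i lt; apply: DT_var.
  by move=> y; rewrite !devC E1 E2.
- exists (fun e => iter i D (e 0%N)); first by apply/DT_iter/DT_var.
  by move=> y; rewrite !devX.
- exists (fun e => T e + T' e); first exact: DT_add.
  by move=> y; rewrite !rmorphD /= (E y).1 (E y).2 (E' y).1 (E' y).2.
- exists (fun e => T e * T' e); first exact: DT_mul.
  by move=> y; rewrite !rmorphM /= (E y).1 (E y).2 (E' y).1 (E' y).2.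
Qed.

End DiffPoly.

Section DiffAlgebraic.
Variables (F : fieldType) (D : F -> F) (t : F).
Hypothesis char0 : [pchar F] =i pred0.
Hypothesis Dder : derivation +%R *%R D.
Hypothesis Dt : D t = 1.
Local Notation I := (i_tD D t).
Local Notation DT := (DT D t).
Local Notation dev f N y := (@dev F D _ f N y).
Implicit Types (n : nat) (e : nat -> F) (T : (nat -> F) -> F).

(* A polynomial over [{mpoly A[M]}] is a differential polynomial of order [M],
   its indeterminate standing for the [M]-th derivative. *)
Definition upev (A : comNzRingType) (f : {rmorphism A -> F}) M y
    (p : {poly {mpoly A[M]}}) : F := (map_poly (dev f M y) p).[iter M D y].

HB.instance Definition _ A f M y := GRing.RMorphism.copy (@upev A f M y)
  (horner_eval (iter M D y) \o map_poly (dev f M y)).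

Section MinimalPolynomial.
Variables (A : comNzRingType) (f : {rmorphism A -> F}).

Lemma upevC M y c : upev f y (c%:P : {poly {mpoly A[M]}}) = dev f M y c.
Proof. by rewrite /upev map_polyC hornerC. Qed.

Lemma upevX M y : upev f y ('X : {poly {mpoly A[M]}}) = iter M D y.
Proof. by rewrite /upev map_polyX hornerX. Qed.

Lemma upev_muni M y (P : {mpoly A[M.+1]}) : upev f y (muni P) = dev f M.+1 y P.
Proof.
elim/mpoly_ring_ind: P => [c|i|p q IHp IHq|p q IHp IHq].
- by rewrite muniC upevC !devC.
- have [->|[j ->]] := ord_widenP i; first by rewrite muniXU_max upevX devX.
  by rewrite muniXU upevC !devX.
- by rewrite muniD !rmorphD; congr (_ + _).
- by rewrite muniM !rmorphM; congr (_ * _).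
Qed.

Hypothesis f_inj : injective f.

(** The minimal differential polynomial of $y$: the order $M$ is least because the lower derivatives
    are independent, and the degree in the $M$-th derivative is least for that order. *)
Record min_rel M y (p : {poly {mpoly A[M]}}) : Prop := MinRel {
  min_rel0 : p != 0;
  min_rel_root : upev f y p = 0;
  min_rel_indep : forall h : {mpoly A[M]}, dev f M y h = 0 -> h = 0;
  min_rel_min : forall q : {poly {mpoly A[M]}}, upev f y q = 0 -> (size q <
    size p)%N -> q = 0 }.

Lemma min_rel_exists N y (P : {mpoly A[N]}) : P != 0 -> dev f N y P = 0 ->
  exists M p, @min_rel M y p.
Proof.
move=> P0 PE.
pose R N := `[< exists2 P : {mpoly A[N]}, P != 0 & dev f N y P = 0 >].
have exR : exists N, R N by exists N; apply/asboolP; exists P.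
(* Without any derivative the relation would be a nonzero constant killed by the injection [f]. *)
case: (ex_minnP exR) => -[|M] /asboolP[{PE}{}P {}P0 PE] minM.
  move: P0 PE; rewrite (mpoly0_const P) devC mpolyC_eq0 => /negP h PE; case: h.
  by apply/eqP/f_inj; rewrite PE rmorph0.
pose S k := `[< exists p : {poly {mpoly A[M]}},
                 [/\ p != 0, upev f y p = 0 & size p = k] >].
have exS : exists k, S k.
  exists (size (muni P)); apply/asboolP; exists (muni P); split=> //.
    by apply: contra_neq P0 => E; rewrite -[P]muniK E -(muni0 M A) muniK.
  by rewrite upev_muni.
case: (ex_minnP exS) => k /asboolP[p [p0 pE <-]] mink.
exists M, p; split=> // [h hE|q qE lt].
  apply: contrapT => /eqP h0; suff /minM : R M by rewrite ltnn.
  by apply/asboolP; exists h.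
apply: contrapT => /eqP q0; move: lt; rewrite ltnNge mink //.
by apply/asboolP; exists q.
Qed.

Lemma min_rel_dev_inj M y p : @min_rel M y p -> injective (dev f M y).
Proof.
move=> H a b /eqP; rewrite -subr_eq0 -rmorphB => /eqP/(min_rel_indep H)/eqP.
by rewrite subr_eq0 => /eqP.
Qed.

Lemma min_rel_size M y p : @min_rel M y p -> (1 < size p)%N.
Proof.
move=> H; rewrite ltnNge; apply/negP => /size1_polyC E.
have := min_rel_root H; have := min_rel0 H; rewrite E upevC => p0.
by move=> /(min_rel_indep H) h; rewrite h eqxx in p0.
Qed.

(** The separant is shorter than [p], so if it vanished at $y$ it would be zero. In characteristic 0
    this would make [p] constant. *)
Lemma min_rel_separant M y p : @min_rel M y p -> upev f y p^`() != 0.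
Proof.
move=> H; apply/eqP => /(min_rel_min H) h.
have p'0 : p^`() = 0 by apply: h; exact: lt_size_deriv (min_rel0 H).
have := congr1 (coefp (size p).-2) p'0; rewrite /= coef_deriv coef0.
have lt := min_rel_size H; rewrite (_ : (size p).-2.+1 = (size p).-1);
  last by lia.
rewrite -lead_coefE -mulr_natr => /(congr1 (dev f M y)) /eqP.
rewrite rmorphM rmorph_nat rmorph0 /= mulf_eq0 natf_eq0 // => /orP[/eqP|];
  last first.
  by move/eqP => E; move: lt; rewrite -subn_gt0 subn1 E.
by move/(min_rel_indep H)/eqP; rewrite lead_coef_eq0 (negbTE (min_rel0 H)).
Qed.

End MinimalPolynomial.

Section DerivePoly.
Variables (A : comNzRingType) (f g : {rmorphism A -> F}) (G : F -> F -> Prop).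
Hypothesis GD : forall x x' y y', G x x' -> G y y' -> G (x + y) (x' + y').
Hypothesis GM : forall x x' y y', G x x' -> G y y' -> G (x * y) (x' * y').
Hypothesis Gfg : forall a, G (f a) (g a).
Hypothesis fg_der : forall a, exists2 b, f b = D (f a) & g b = D (g a).
Variables (M : nat) (c d : F).
Hypothesis Gcd : forall i, (i <= M)%N -> G (iter i D c) (iter i D d).

(** [G] has two instances: membership of the first argument in a field, in [cl_fg], and the graph of
    a field isomorphism, in [min_rel_extend]. *)
Lemma rel_dev (h : {mpoly A[M]}) :
  G (dev f M c h) (dev g M d h) /\ G (D (dev f M c h)) (D (dev g M d h)).
Proof.
elim/mpoly_ring_ind: h => [a|i|p q [Hp Hp'] [Hq Hq']|p q [Hp Hp'] [Hq Hq']].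
- by rewrite !devC; split=> //; have [b <- <-] := fg_der a.
- by rewrite !devX; split; [|rewrite -!iterS]; apply: Gcd => //; apply: ltnW.
- by rewrite !rmorphD /= !(derD Dder); split;
    [exact: GD Hp Hq|exact: GD Hp' Hq'].
- rewrite !rmorphM /= !(derM Dder); split; first exact: GM Hp Hq.
  exact: GD (GM Hp Hq') (GM Hp' Hq).
Qed.

Lemma rel_upev (p : {poly {mpoly A[M]}}) : G (upev f c p) (upev g d p).
Proof.
elim/poly_ind: p => [|p a IH]; first by have := Gfg 0; rewrite !rmorph0.
rewrite !rmorphD !rmorphM /= !upevX !upevC.
exact: GD (GM IH (Gcd (leqnn M))) (rel_dev a).1.
Qed.

(** By the Leibniz rule only the separant term involves the derivative of order $M+1$. At a root of
    [p] this term can be solved for that derivative. *)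
Lemma rel_upev_der (p : {poly {mpoly A[M]}}) : exists x x', [/\ G x x',
  D (upev f c p) = x + upev f c p^`() * iter M.+1 D c &
  D (upev g d p) = x' + upev g d p^`() * iter M.+1 D d].
Proof.
elim/poly_ind: p => [|p a [x [x' [Gx E E']]]].
  exists (f 0), (g 0); split=> //.
    by rewrite deriv0 !rmorph0 (der0 Dder) mul0r addr0.
  by rewrite deriv0 !rmorph0 (der0 Dder) mul0r addr0.
exists (x * iter M D c + D (dev f M c a)), (x' * iter M D d + D (dev g M d a)).
split.
- exact: GD (GM Gx (Gcd (leqnn M))) (rel_dev a).2.
- rewrite derivMXaddC !rmorphD !rmorphM /= !upevX !upevC (derD Dder) (derM
    Dder) E /=; ring.
- rewrite derivMXaddC !rmorphD !rmorphM /= !upevX !upevC (derD Dder) (derM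
    Dder) E' /=; ring.
Qed.

End DerivePoly.

(* [cl] and [fg] are equivalent; the second one is visibly transitive. *)
Definition cl n e y := exists2 T, DT n.+1 T & T (y .: e) = 0 /\ nonzero e T.

(** The field generated by [B] and the values of terms at [e]. In [fg] the generators need not be
    derivatives of $y$, so lists can simply be concatenated. *)
Inductive frac n e (B : seq F) : F -> Prop :=
| frac_Ter T : Ter I n T -> frac n e B (T e)
| frac_gen b : b \in B -> frac n e B b
| fracD x y : frac n e B x -> frac n e B y -> frac n e B (x + y)
| fracN x : frac n e B x -> frac n e B (- x)
| fracM x y : frac n e B x -> frac n e B y -> frac n e B (x * y)
| fracV x : frac n e B x -> frac n e B x^-1.

Definition fg n e y := exists B, forall m, frac n e B (iter m D y).

Lemma frac_DT n e B T : DT n T -> frac n e B (T e).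
Proof.
move=> [T1 [T2 [h1 h2 ->]]]; apply: fracD; first exact: frac_Ter.
by apply: fracN; apply: frac_Ter.
Qed.

Lemma frac_der n e B x : (forall b, b \in B -> frac n e B (D b)) ->
  frac n e B x -> frac n e B (D x).
Proof.
move=> hB; elim=> {x} [T hT|b /hB //|x y _ hx _ hy|x _ hx|x y fx hx fy hy|x fx
  hx].
- exact: frac_Ter (Ter_der hT).
- by rewrite (derD Dder); apply: fracD.
- by rewrite (derN Dder); apply: fracN.
- by rewrite (derM Dder); apply: fracD; apply: fracM.
- by rewrite (derV Dder) expr2; apply: fracM (fracN hx) (fracV (fracM fx fx)).
Qed.

(** A minimal relation of order $M$ expresses $\mathrm D^{M+1}y$ through lower derivatives, with the
    separant as denominator. The field generated by $y,\dots,\mathrm D^My$ is then closed under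
    $\mathrm D$. *)
Lemma cl_fg n e y : cl n e y -> fg n e y.
Proof.
(* With both tuples equal to [e], the ring of pairs is the differential ring generated by [e] and
   $t$. *)
move=> [T hT [T0 [y0 Ty0]]]; pose f := pair1 D t n e e.
have fI : injective f by apply: pair1_inj.
have fder a : exists b, f b = D (f a) by have [b] := pair_der Dder a; exists b.
have fv T' : DT n T' -> exists a, f a = T' e.
  by move=> /(pair_of e e)[a]; exists a.
have [||N [P HP]] := DT_dev Dder fder (e := e) _ _ hT.
- by move=> i lt; apply: (fv (fun e => e i)); apply: DT_var.
- exact: (fv (fun=> t) (DT_Ter (Ter_t _ _ _))).
have P0 : P != 0 by apply: contra_neq Ty0 => E; rewrite HP E rmorph0.
rewrite HP in T0; have [M [p Hp]] := min_rel_exists fI P0 T0.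
pose B := [seq iter i D y | i <- iota 0 M.+1].
have Bi i : (i <= M)%N -> frac n e B (iter i D y).
  by move=> le; apply: frac_gen; apply/mapP; exists i; rewrite ?mem_iota.
have [|||||x [_ [fx E _]]] := @rel_upev_der _ f f (fun x _ => frac n e B x)
   _ _ _ _ M y y _ p.
- by move=> x _ z _; apply: fracD.
- by move=> x _ z _; apply: fracM.
- by move=> a; have [T' hT' [-> _]] := pair_DT a; apply: frac_DT.
- by move=> a; have [b] := fder a; exists b.
- exact: Bi.
have sep := min_rel_separant Hp.
have fM1 : frac n e B (iter M.+1 D y).
  rewrite (_ : iter _ _ _ = - x / upev f y p^`()).
    apply: fracM (fracN fx) (fracV _).
    apply: (@rel_upev _ f f (fun x _ => frac n e B x)) => //.
    - by move=> z _ w _; apply: fracD.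
    - by move=> z _ w _; apply: fracM.
    - by move=> a; have [T' hT' [-> _]] := pair_DT a; apply: frac_DT.
    - by move=> a; have [b] := fder a; exists b.
  move: E; rewrite (min_rel_root Hp) (der0 Dder) => /esym/eqP.
  by rewrite addr_eq0 => /eqP ->; rewrite opprK mulrC mulKf.
exists B; elim=> [|m IH]; first exact: (Bi 0%N).
apply: frac_der IH => b /mapP[i]; rewrite mem_iota /= add0n ltnS => /= le ->.
by move: le; rewrite leq_eqVlt => /orP[/eqP->//|]; apply: (Bi i.+1).
Qed.

End DiffAlgebraic.

(** * Finite generation and transitivity of differential algebraicity *)

Section FgClosure.
Variables (F : fieldType) (D : F -> F) (t : F).
Hypothesis char0 : [pchar F] =i pred0.
Hypothesis Dder : derivation +%R *%R D.
Hypothesis Dt : D t = 1.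
Local Notation I := (i_tD D t).
Local Notation DT := (DT D t).
Local Notation frac := (frac D t).
Local Notation fg := (fg D t).
Local Notation cl := (cl D t).
Implicit Types (n : nat) (e : nat -> F) (T : (nat -> F) -> F).

Lemma frac_quot n e (B : seq F) x : frac n e B x ->
  let f := pair1 D t n e e in
  exists P Q : {mpoly pair_ring D t n e e[size B]},
    (map_mpoly f Q).@[fun i => B`_i] != 0 /\
    x = (map_mpoly f P).@[fun i => B`_i] / (map_mpoly f Q).@[fun i => B`_i].
Proof.
move=> fx f; pose ev : {rmorphism {mpoly pair_ring D t n e e[size B]} -> F} :=
  meval (fun i : 'I_(size B) => B`_i) \o map_mpoly f.
have evE P : ev P = (map_mpoly f P).@[fun i => B`_i] by [].
suff: exists P Q, ev Q != 0 /\ x = ev P / ev Q by [].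
elim: {x} fx => [T hT|b hb|x y _ [P [Q [Q0 ->]]] _ [P' [Q' [Q0' ->]]]
  |x _ [P [Q [Q0 ->]]]|x y _ [P [Q [Q0 ->]]] _ [P' [Q' [Q0' ->]]]|x _ [P [Q [Q0
    ->]]]].
- have [a Ea _] := pair_of e e (DT_Ter hT).
  exists a%:MP, 1; rewrite rmorph1 divr1; split; first exact: oner_neq0.
  by rewrite evE map_mpolyC mevalC -Ea.
- have lt : (index b B < size B)%N by rewrite index_mem.
  exists 'X_(Ordinal lt), 1; rewrite rmorph1 divr1; split;
    first exact: oner_neq0.
  by rewrite evE map_mpolyX mevalXU nth_index.
- exists (P * Q' + P' * Q), (Q * Q'); rewrite rmorphD !rmorphM mulf_neq0 //.
  by split=> //; rewrite addf_div.
- by exists (- P), Q; rewrite rmorphN mulNr.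
- exists (P * P'), (Q * Q'); rewrite !rmorphM mulf_neq0 //.
  by split=> //; rewrite mulf_div.
(* The inverse of zero is zero by convention and needs a fraction of its own. *)
have [P0|P0] := eqVneq (ev P) 0.
  by exists 0, 1; rewrite P0 rmorph0 rmorph1 mul0r invr0 mul0r oner_neq0.
by exists Q, P; rewrite invf_div.
Qed.

(** If the field has $N$ generators, the $N+1$ elements $y,\dots,\mathrm D^Ny$ are algebraically
    dependent, which is a differential equation for $y$. *)
Lemma fg_cl n e y : fg n e y -> cl n e y.
Proof.
move=> [B hB]; pose f := pair1 D t n e e; pose N := size B.
have fI : injective f by apply: pair1_inj.
have /choice[P /choice[Q HPQ]] (i : 'I_N.+1) := frac_quot (hB i).
have [|p p0 pE] := @algebraic_dependence _ F f fI N P Q (fun i => B`_i).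
  by move=> i; have [] := HPQ i.
have {}pE : dev D f y p = 0.
  rewrite -{}pE /dev /dpeval; apply: meval_eq => i.
  by have [_] := HPQ i.
have [T hT HT] := dev_DT Dder p.
exists T => //; rewrite (HT y).1 pE; split=> //.
have [r _ hr] := dev_dense char0 Dder Dt fI p0.
by exists r; rewrite (HT r).1.
Qed.

Lemma frac_sub n e B B' x : {subset B <= B'} -> frac n e B x -> frac n e B' x.
Proof.
move=> h; elim=> {x} [T|b /h|x y _ hx _ hy|x _ hx|x y _ hx _ hy|x _ hx].
- exact: frac_Ter.
- exact: frac_gen.
- exact: fracD.
- exact: fracN.
- exact: fracM.
- exact: fracV.
Qed.

Lemma fg_DT n e T : DT n T -> fg n e (T e).
Proof. by move=> hT; exists [::] => m; apply: frac_DT (DT_iter Dder m hT). Qed.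

Lemma fgB n e x y : fg n e x -> fg n e y -> fg n e (x - y).
Proof.
move=> [B hB] [B' hB']; exists (B ++ B') => m.
rewrite (iter_derD Dder) (iter_derN Dder); apply: fracD; last apply: fracN.
  by apply: frac_sub (hB m) => b; rewrite mem_cat => ->.
by apply: frac_sub (hB' m) => b; rewrite mem_cat orbC => ->.
Qed.

Lemma frac_iterM n e B m x y :
  (forall k, frac n e B (iter k D x)) -> (forall k, frac n e B (iter k D y)) ->
  frac n e B (iter m D (x * y)).
Proof.
elim: m x y => [|m IH] x y hx hy; first by apply: fracM (hx 0%N) (hy 0%N).
rewrite iterSr (derM Dder) (iter_derD Dder).
by apply: fracD; apply: IH => // k; rewrite -iterSr.
Qed.

(** All derivatives of the [e' i] lie in one finitely generated field over [e], hence so do all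
    values of terms at [e']. *)
Lemma fg_trans k e' n e y : (forall i, (i < k)%N -> fg n e (e' i)) ->
  fg k e' y -> fg n e y.
Proof.
move=> he' [B hB].
have [B' hB'] : exists B', forall i, (i < k)%N -> forall m, frac n e B' (iter m
  D (e' i)).
  elim: k he' {hB} => [|k IH] h; first by exists [::].
  have [|B1 h1] := IH; first by move=> i lt; apply: h; apply: ltnW.
  have [B2 h2] := h k (ltnSn k); exists (B1 ++ B2) => i; rewrite ltnS leq_eqVlt.
  case/orP=> [/eqP->|/h1 {}h1] m.
    by apply: frac_sub (h2 m) => b; rewrite mem_cat orbC => ->.
  by apply: frac_sub (h1 m) => b; rewrite mem_cat => ->.
have hT T : Ter I k T -> forall m, frac n e B' (iter m D (T e')).
  elim/(@Ter_ind F D t) => //.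
  - by move=> m; apply: (frac_DT _ _ (DT_iter Dder m (DT_Ter (Ter_0 _ _ n)))).
  - by move=> m; apply: (frac_DT _ _ (DT_iter Dder m (DT_Ter (Ter_1 _ _ n)))).
  - by move=> m; apply: (frac_DT _ _ (DT_iter Dder m (DT_Ter (Ter_t _ _ n)))).
  - by move=> T1 T2 h1 h2 m; rewrite (iter_derD Dder); apply: fracD.
  - by move=> T1 T2 h1 h2 m; apply: frac_iterM.
  - by move=> T1 h1 m; rewrite -iterSr.
exists (B ++ B') => m; elim: (hB m) => [T /hT h|b hb|x z _ hx _ hz|x _ hx|x z _
  hx _ hz|x _ hx].
- by apply: frac_sub (h 0%N) => b; rewrite mem_cat orbC => ->.
- by apply: frac_gen; rewrite mem_cat hb.
- exact: fracD.
- exact: fracN.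
- exact: fracM.
- exact: fracV.
Qed.

End FgClosure.

(** * Saturation and generic elements *)

Definition eapp M n (x z : nat -> M) (i : nat) : M :=
  if (i < n)%N then x i else z (i - n)%N.

Lemma eappS M n (x z : nat -> M) :
  eapp n.+1 x z = x 0%N .: eapp n (fun i => x i.+1) z.
Proof. by apply/funext => -[|i]; rewrite /eapp //= ltnS subSS. Qed.

Lemma eapp0 M (x z : nat -> M) : eapp 0 x z = z.
Proof. by apply/funext => i; rewrite /eapp subn0. Qed.

Lemma eapp2 M (x z : nat -> M) : eapp 2 x z = x 0%N .: x 1%N .: z.
Proof. by rewrite !eappS eapp0. Qed.

Section Compactness.
Variables (F : fieldType) (D : F -> F) (t : F).
Hypothesis char0 : [pchar F] =i pred0.
Hypothesis hsat : saturated (i_D D).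
Local Notation I := (i_tD D t).

Lemma small_seq (s : seq F) : small (fun x => x \in s).
Proof.
case=> f fI; pose h i := sval (f i%:R).
have hI : injective h by move=> i j /val_inj/fI/natf_inj; apply.
have := @uniq_leq_size _ [seq h i | i <- iota 0 (size s).+1] s.
rewrite map_inj_uniq // iota_uniq size_map size_iota ltnn => /(_ isT) H.
suff /H : {subset [seq h i | i <- iota 0 (size s).+1] <= s} by [].
by move=> _ /mapP[i _ ->]; exact: (svalP (f i%:R)).
Qed.

Lemma compactness n k (z : nat -> F) (Q : ((nat -> F) -> Prop) -> Prop) :
  (forall S, Q S -> Def I (n + k) S) ->
  (forall s, (forall S, List.In S s -> Q S) ->
     exists x, forall S, List.In S s -> S (eapp n x z)) ->
  exists x, forall S, Q S -> S (eapp n x z).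
Proof.
(* $t$ counts among the parameters, as saturation is assumed for the language without it. *)
move=> QDef Qfin; pose s := t :: [seq z i | i <- iota 0 k].
have smalls := small_seq (s := s); have H := hsat smalls; clear smalls.
pose IA := isum (i_D D) (iconst (fun c : {x : F | x \in s} => sval c)).
have Ter_c n' c : c \in s -> Ter IA n' (fun=> c).
  move=> cs; apply: Ter_ext (@Ter_app _ _ IA n' (inr (exist _ c cs)) (fun _ _
    => 0) _) _ => //.
  by case.
have QA S : Q S -> Def IA n (fun x => S (eapp n x z)).
  move=> /QDef hS; apply: (Def_transfer
      (s := fun i x => if (i < n)%N then x i else z (i - n)%N) _ _ hS).
  - move=> [[f|[]]|[]] m T hT; last exact: (@Ter_app _ _ IA m (inl (inr tt))).
      exact: (@Ter_app _ _ IA m (inl (inl f))).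
    by apply: Ter_c; rewrite inE eqxx.
  - by move=> [[[]|[]]|[]].
  - move=> i lt; case: ltnP => lein; first exact: Ter_var.
    apply: Ter_c; rewrite inE map_f ?orbT // mem_iota; lia.
pose p (phi : formula _ n) := exists2 S, Q S &
  forall x, sat IA phi (etup n x) <-> S (eapp n x z).
have [s' hs'|v Hv] := H n p.
  have [l [lQ lS]] : exists l, (forall S, List.In S l -> Q S) /\
      forall phi, List.In phi s' -> exists2 S, List.In S l &
        forall x, sat IA phi (etup n x) <-> S (eapp n x z).
    elim: s' hs' => [|phi s' IH] h; first by exists [::].
    have [l [lQ lS]] := IH (fun phi h' => h _ (or_intror h')).
    have [S QS HS] := h phi (or_introl erefl); exists (S :: l); split.
      by move=> S' [<-//|/lQ].
    move=> phi' [<-|/lS[S' h1 h2]]; first by exists S => //; left.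
    by exists S' => //; right.
  have [x Hx] := Qfin l lQ; exists (etup n x) => phi /lS[S /Hx h E].
  by apply/E.
exists (nth 0 v) => S QS; have [phi Hphi] := QA S QS.
by rewrite -Hphi etup_nth; apply: Hv; exists S.
Qed.

End Compactness.

Section Generic.
Variables (F : fieldType) (D : F -> F) (t : F).
Hypothesis char0 : [pchar F] =i pred0.
Hypothesis Dder : derivation +%R *%R D.
Hypothesis Dt : D t = 1.
Hypothesis hsat : saturated (i_D D).
Local Notation I := (i_tD D t).
Local Notation DT := (DT D t).
Local Notation cl := (cl D t).
Implicit Types (n k : nat) (e z : nat -> F) (T : (nat -> F) -> F).

Definition nonzero2 z T := exists r s, T (r .: s .: z) != 0.

Lemma nonzero2_dense k z T : DT k.+2 T -> nonzero2 z T ->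
  exists r s, [/\ nat_t t r, nat_t t s & T (r .: s .: z) != 0].
Proof.
move=> hT [r0 [s0 h0]].
have [|r hr h1] := nonzero_dense char0 Dder Dt (e := s0 .: z) hT.
  by exists r0.
have [||s hs h2] := nonzero_dense char0 Dder Dt (n := k.+1) (e := r .: z)
    (T := fun e => T (e 1%N .: e 0%N .: fun i => e i.+2)).
- have := DT_subst Dder (n := k.+2) (s := fun i e =>
    match i with 0 => e 1 | 1 => e 0 | _ => e i end)%N hT.
  move=> H; apply: DT_ext (H _) _; first by case=> [|[|i]] lt; apply: DT_var.
  by move=> e; congr T; apply/funext => -[|[]].
- by exists s0.
by exists r, s.
Qed.

(** From two good pairs, first one $s$ is found that suits both $r_1$ and $r_2$, then one $r$ that
    suits this $s$ for both factors. *)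
Lemma nonzero2M k z T T' : DT k.+2 T -> DT k.+2 T' ->
  nonzero2 z T -> nonzero2 z T' -> nonzero2 z (fun e => T e * T' e).
Proof.
move=> hT hT' [r1 [s1 h1]] [r2 [s2 h2]].
have DTs T0 j : (j = 1 \/ j = 2)%N -> DT k.+2 T0 ->
    DT k.+3 (fun e => T0 (e j .: e 0%N .: fun i => e i.+3)).
  move=> hj hT0; have := DT_subst Dder (n := k.+3) (s := fun i e =>
    match i with 0 => e j | 1 => e 0 | _ => e i.+1 end)%N hT0.
  move=> H; apply: DT_ext (H _) _.
    by case=> [|[|i]] lt; apply: DT_var => //; case: hj => ->.
  by move=> e; congr T0; apply/funext => -[|[]].
have [||||s] := nonzeroM char0 Dder Dt (n := k.+2) (e := r1 .: r2 .: z)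
   (T := fun e => T (e 1%N .: e 0%N .: fun i => e i.+3))
   (T' := fun e => T' (e 2%N .: e 0%N .: fun i => e i.+3)).
- by apply: DTs => //; left.
- by apply: DTs => //; right.
- by exists s1.
- by exists s2.
rewrite mulf_eq0 negb_or => /andP[{}h1 {}h2].
have [||r] := nonzeroM char0 Dder Dt (e := s .: z) hT hT'.
- by exists r1.
- by exists r2.
by move=> h; exists r, s.
Qed.

Lemma DT_const1 n : DT n (fun=> 1).
Proof. exact/DT_Ter/Ter_1. Qed.

(** Finitely many inequations amount to one for their product. It has a solution in $\mathbb N[t]$,
    where [S] holds, and compactness does the rest. *)
Lemma generic_pair k z S : Def I k.+2 S ->
  (forall r s, nat_t t r -> nat_t t s -> S (r .: s .: z)) ->
  exists r s, S (r .: s .: z) /\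
    forall T, DT k.+2 T -> nonzero2 z T -> T (r .: s .: z) != 0.
Proof.
move=> hS Sz.
pose Q S' := S' = S \/ exists T, [/\ DT k.+2 T, nonzero2 z T &
  S' = fun e => T e <> 0].
have [x Hx] : exists x, forall S', Q S' -> S' (eapp 2 x z).
  apply: (compactness (t := t) char0 hsat (k := k)).
  - move=> S' [->//|[T [[T1 [T2 [h1 h2 E]]] _ ->]]].
    apply: Def_ext (Def_not (Def_eq h1 h2)) _ => e.
    by rewrite E; split=> h; [move/eqP; rewrite subr_eq0 => /eqP|move=> E';
      apply: h; rewrite E' subrr].
  - move=> l lQ; have [T [hT T0 HT]] : exists T, [/\ DT k.+2 T, nonzero2 z T &
      forall r s,
        nat_t t r -> nat_t t s -> T (r .: s .: z) != 0 ->
        forall S', List.In S' l -> S' (r .: s .: z)].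
      elim: l lQ => [|S' l IH] lQ.
        exists (fun=> 1); split=> //; first exact: DT_const1.
        by exists 0, 0; exact: oner_neq0.
      have [T [hT T0 HT]] := IH (fun S' h => lQ S' (or_intror h)).
      have [->|[T' [hT' T'0 ->]]] := lQ S' (or_introl erefl).
        exists T; split=> // r s hr hs Trs S'' [<-|]; first exact: Sz.
        exact: HT.
      exists (fun e => T e * T' e); split; first exact: DT_mul.
        exact: (nonzero2M hT hT').
      move=> r s hr hs; rewrite mulf_eq0 negb_or => /andP[h1 h2] S'' [<-|].
        exact/eqP.
      exact: HT.
    have [r [s [hr hs Trs]]] := nonzero2_dense hT T0.
    by exists (r .: fun=> s) => S' /(HT r s hr hs Trs); rewrite eapp2.
exists (x 0%N), (x 1%N); split; first by rewrite -eapp2; apply: Hx; left.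
move=> T hT T0; rewrite -eapp2; apply/eqP.
by apply: (Hx (fun e => T e <> 0)); right; exists T.
Qed.

Lemma generic_exists k z S : Def I k.+1 S ->
  (forall r, nat_t t r -> S (r .: z)) ->
  exists y, S (y .: z) /\ ~ cl k z y.
Proof.
move=> hS Sz.
have sk T : DT k.+1 T -> DT k.+2 (fun e => T (e 0%N .: fun i => e i.+2)).
  move=> hT; have := DT_subst Dder (n := k.+2) (s := fun i e =>
    match i with 0 => e 0 | _ => e i.+1 end)%N hT.
  move=> H; apply: DT_ext (H _) _; first by case=> [|i] lt; apply: DT_var.
  by move=> e; congr T; apply/funext => -[].
have [||r [s [Srs gen]]] := @generic_pair k z
    (fun e => S (e 0%N .: fun i => e i.+2)).
- have := Def_subst (n := k.+2) (s := fun i e =>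
    match i with 0 => e 0 | _ => e i.+1 end)%N hS.
  move=> H; apply: Def_ext (H _) _; first by case=> [|i] lt; apply: Ter_var.
  move=> e; rewrite (_ : (fun i => _) = (e 0%N .: fun i => e i.+2)) //.
  by apply/funext => -[].
- by move=> r s hr _; apply: Sz.
exists r; split=> // -[T hT [T0 [y Ty]]].
by have /eqP[] := gen _ (sk T hT) (ex_intro _ y (ex_intro _ 0 Ty)).
Qed.

End Generic.

(** * Back and forth between differentially closed fields *)

Section TransferRoots.
Variables (B : comNzRingType) (F : fieldType) (f g : {rmorphism B -> F}).
Hypotheses (f_inj : injective f) (g_inj : injective g).
Variables (c d : F) (p : {poly B}).
Hypothesis p0 : p != 0.
Hypothesis pc : (map_poly f p).[c] = 0.
Hypothesis pmin :
  forall q, (map_poly f q).[c] = 0 -> (size q < size p)%N -> q = 0.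
Hypothesis pd : (map_poly g p).[d] = 0.

Local Notation evc q := (map_poly f q).[c].
Local Notation evd q := (map_poly g q).[d].

Lemma size_mapf q : size (map_poly f q) = size q.
Proof. by apply: size_map_inj_poly => //; exact: rmorph0. Qed.

Lemma inj_lead_coef_neq0 (h : {rmorphism B -> F}) q :
  injective h -> q != 0 -> h (lead_coef q) != 0.
Proof.
move=> hI q0; apply: contra_neq q0 => E; apply/eqP; rewrite -lead_coef_eq0.
by apply/eqP/hI; rewrite E rmorph0.
Qed.

Lemma evcZ (h : {rmorphism B -> F}) x b q :
  (map_poly h (b *: q)).[x] = h b * (map_poly h q).[x].
Proof. by rewrite map_polyZ hornerZ. Qed.

(** Pseudo-division of [q] by [p] leaves a remainder that vanishes at $c$ and is shorter than [p],
    hence zero. A multiple of [q] by a scalar that [g] does not kill is thus a multiple of [p]. *)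
Lemma root_transfer_to q : evc q = 0 -> evd q = 0.
Proof.
move=> qc; have E := Pdiv.ComRing.rdivp_eq p q.
have r0 : Pdiv.Ring.rmodp q p = 0.
  apply: pmin; last by rewrite Pdiv.Ring.ltn_rmodp.
  have := congr1 (fun q => evc q) E.
  by rewrite evcZ rmorphD rmorphM hornerD hornerM pc qc !mulr0 add0r.
have := congr1 (fun q => evd q) E.
rewrite r0 addr0 evcZ rmorphM hornerM pd mulr0 => /eqP.
by rewrite mulf_eq0 rmorphXn expf_eq0 (negbTE (inj_lead_coef_neq0 _ _)) //
  andbF => /eqP.
Qed.

(* The Euclidean algorithm produces a nonzero constant in the ideal generated
   by [p] and any [q] not vanishing at [c]. *)
Lemma root_transfer_from q : evd q = 0 -> evc q = 0.
Proof.
move=> qd; apply: contrapT => /eqP qc.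
(* A member of the ideal that does not vanish at $c$ is taken of least size. It vanishes at $d$ and
   so is not constant. *)
pose Id m := (exists u v, m = u * q + v * p) /\ evc m != 0.
pose S k := `[< exists m, Id m /\ size m = k >].
have exS : exists k, S k.
  exists (size q); apply/asboolP; exists q; split=> //; split=> //.
  by exists 1, 0; rewrite mul1r mul0r addr0.
case: (ex_minnP exS) => k /asboolP[m [[[u [v Em]] mc] <-]] mink.
have evd_m : evd m = 0 by rewrite Em rmorphD !rmorphM hornerD !hornerM qd pd
  !mulr0 addr0.
have m0 : m != 0 by apply: contra_neq mc => ->; rewrite rmorph0 horner0.
have lep0 : f (lead_coef p) != 0 by apply: inj_lead_coef_neq0.
have lt_mp : (size m < size p)%N.
  have E := Pdiv.ComRing.rdivp_eq p m; set r := Pdiv.Ring.rmodp m p in E.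
  apply: leq_ltn_trans (_ : size r < _)%N; last by rewrite Pdiv.Ring.ltn_rmodp.
  apply: mink; apply/asboolP; exists r; split=> //; split.
    exists (lead_coef p ^+ Pdiv.Ring.rscalp m p *: u).
    exists (lead_coef p ^+ Pdiv.Ring.rscalp m p *: v - Pdiv.Ring.rdivp m p).
    rewrite -!scalerAl mulrBl addrA -scalerAl -scalerDr -Em E; ring.
  have := congr1 (fun q => evc q) E.
  rewrite evcZ rmorphD rmorphM hornerD hornerM pc mulr0 add0r => <-.
  by rewrite mulf_neq0 // rmorphXn expf_neq0.
have [sm1|sm1] := leqP (size m) 1.
  move: evd_m mc; rewrite (size1_polyC sm1) !map_polyC !hornerC /= => gm.
  suff -> : m`_0 = 0 by rewrite rmorph0 eqxx.
  by apply: g_inj; rewrite gm rmorph0.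
(* The remainder [r] vanishes at $c$ by minimality of [m], hence is zero by minimality of [p]. Then
   the quotient [s] vanishes at $c$ and is shorter than [p], so it is zero too, and so would be
   [p]. *)
have E := Pdiv.ComRing.rdivp_eq m p.
set r := Pdiv.Ring.rmodp p m in E; set s := Pdiv.Ring.rdivp p m in E.
set l := lead_coef m ^+ _ in E.
have l0 : f l != 0 by rewrite rmorphXn expf_neq0 // inj_lead_coef_neq0.
have lt_rm : (size r < size m)%N by rewrite Pdiv.Ring.ltn_rmodp.
have rc : evc r = 0.
  apply: contrapT => /eqP rc; suff /mink : S (size r) by rewrite leqNgt lt_rm.
  apply/asboolP; exists r; split=> //; split=> //.
  exists (- s * u), (l%:P - s * v); have -> : r = l *: p - s * m by rewrite E;
    ring.
  by rewrite Em -mul_polyC; ring.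
have r0 : r = 0 by apply: pmin rc (ltn_trans lt_rm lt_mp).
have sc : evc s = 0.
  have := congr1 (fun q => evc q) E.
  rewrite evcZ r0 addr0 rmorphM hornerM pc mulr0 => /esym/eqP.
  by rewrite mulf_eq0 (negbTE mc) orbF => /eqP.
have s0 : s = 0.
  apply: pmin sc _.
  have [->|s0] := eqVneq s 0; first by rewrite size_poly0 size_poly_gt0.
  have := congr1 (fun q => size (map_poly f q)) E.
  rewrite r0 addr0 map_polyZ rmorphM size_scale // size_mul ?size_mapf.
  - by move=> ->; lia.
  - by rewrite -size_poly_eq0 size_mapf size_poly_eq0.
  - by rewrite -size_poly_eq0 size_mapf size_poly_eq0.
have := congr1 (fun q => size (map_poly f q)) E.
rewrite s0 r0 mul0r addr0 map_polyZ size_scale // rmorph0 size_poly0 size_mapf.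
by move/eqP; rewrite size_poly_eq0 (negbTE p0).
Qed.

End TransferRoots.

Section BackAndForth.
Variables (F : fieldType) (D : F -> F) (t : F).
Hypothesis hDCF : DCF0 D.
Hypothesis Dt : D t = 1.
Hypothesis hsat : saturated (i_D D).
Local Notation I := (i_tD D t).
Local Notation DT := (DT D t).
Local Notation cl := (cl D t).
Local Notation eqv := (eqv D t).
Implicit Types (n k : nat) (e z : nat -> F) (T : (nat -> F) -> F).

Let char0 : [pchar F] =i pred0. Proof. by case: hDCF. Qed.
Let Dder : derivation +%R *%R D. Proof. by case: hDCF. Qed.

Lemma eqv_sym k e e' : eqv k e e' -> eqv k e' e.
Proof. by move=> h T hT; rewrite h. Qed.

(* A differential polynomial vanishing on N[t] is zero, and its values there
   are values of terms in the parameters. *)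
Lemma eqv_nonzero k e e' T : DT k.+1 T -> eqv k e e' ->
  nonzero e T -> nonzero e' T.
Proof.
move=> hT ee' /(nonzero_dense char0 Dder Dt hT)[r hr Tr]; exists r.
have := DT_subst Dder (n := k) (s :=
  fun i e => if i is j.+1 then e j else r) hT.
move=> H; rewrite -(ee' (fun e => T (r .: e))) //; apply: DT_ext (H _) _.
  by case=> [|i] lt; [apply/DT_Ter/Ter_nat_t|apply: DT_var].
by move=> e0; congr T; apply/funext => -[].
Qed.

(** An expression vanishes at a generic element only if it is zero over the parameters, a condition
    that [eqv_nonzero] carries across. *)
Lemma eqv_generic k e e' y y' : eqv k e e' -> ~ cl k e y -> ~ cl k e' y' ->
  eqv k.+1 (y .: e) (y' .: e').
Proof.
move=> ee' hy hy' T hT; apply/eqP/eqP => E.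
  have h0 : ~ nonzero e T by move=> h; apply: hy; exists T.
  apply: contrapT => /eqP h; apply: h0.
  by apply: (eqv_nonzero hT (eqv_sym ee')); exists y'.
have h0 : ~ nonzero e' T by move=> h; apply: hy'; exists T.
apply: contrapT => /eqP h; apply: h0.
by apply: (eqv_nonzero hT ee'); exists y.
Qed.

Section Algebraic.
Variables (k : nat) (e e' : nat -> F).
Hypothesis ee' : eqv k e e'.
Local Notation A := (pair_ring D t k e e').
Local Notation f := (pair1 D t k e e').
Local Notation g := (pair2 D t k e e').
Let f_inj : injective f := pair1_inj ee'.
Let g_inj : injective g := pair2_inj ee'.
Variables (M : nat) (c : F) (p : {poly {mpoly A[M]}}).
Hypothesis hp : min_rel D f c p.

Lemma min_rel_has_order : has_order (map_mpoly g (muni_inv p)).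
Proof.
apply: contrapT => h; have := min_rel_size hp; rewrite ltnNge => /negP; apply.
rewrite -[p]muni_invK; apply: size_muni_const => m hm.
apply: contrapT => /eqP m0; apply: h; exists m => //.
by rewrite (perm_mem (msupp_map_mpoly _ g_inj)).
Qed.

Lemma upev_muni_inv (h : {rmorphism A -> F}) y : upev D h y p = dev D h y
  (muni_inv p).
Proof. by rewrite -upev_muni muni_invK. Qed.

Lemma Def_dev_eq0 N (q : {mpoly A[N]}) :
  exists2 S, Def I k.+1 S & forall y, S (y .: e') <-> dev D g y q = 0.
Proof.
have [T [T1 [T2 [h1 h2 E]]] HT] := dev_DT Dder q.
exists (fun e => T1 e = T2 e); first exact: Def_eq.
by move=> y; rewrite -(HT y).2 E; split=> [->|/eqP];
  rewrite ?subrr // subr_eq0 => /eqP.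
Qed.

(** Blum's axiom gives a root of the transferred [p] at which one prescribed polynomial of lower
    order is nonzero; compactness treats all of them at once. *)
Lemma min_rel_copy : exists d, upev D g d p = 0 /\
  forall h : {mpoly A[M]}, dev D g d h = 0 -> h = 0.
Proof.
have [_ _ blum] := hDCF.
have [Sp hSp HSp] := Def_dev_eq0 (muni_inv p).
pose Q S := S = Sp \/ exists h : {mpoly A[M]}, [/\ h <> 0, Def I k.+1 S &
  forall y, S (y .: e') <-> dev D g y h <> 0].
have appE (x : nat -> F) : eapp 1 x e' = x 0%N .: e' by rewrite eappS eapp0.
have [x Hx] : exists x, forall S, Q S -> S (eapp 1 x e').
  apply: (compactness (t := t) char0 hsat (k := k)).
  - by move=> S [->|[h [_ ? _]]].
  - move=> l lQ; have [h h0 Hh] : exists2 h : {mpoly A[M]}, h <> 0 & forall y,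
        Sp (y .: e') -> dev D g y h <> 0 -> forall S, List.In S l -> S (y .:
          e').
      elim: l lQ => [|S l IH] lQ; first by exists 1 => //; exact/eqP/oner_neq0.
      have [h h0 Hh] := IH (fun S' h => lQ S' (or_intror h)).
      have [->|[h' [h'0 _ HS]]] := lQ S (or_introl erefl).
        by exists h => // y Spy hy S' [<-//|]; apply: Hh.
      exists (h * h').
        (* The product is nonzero because evaluation at $c$ kills no nonzero polynomial of order
           less than $M$. *)
        move=> /(congr1 (dev D f c)); rewrite rmorphM rmorph0 => /eqP.
        rewrite mulf_eq0 => /orP[] /eqP /(min_rel_indep hp) //.
      move=> y Spy; rewrite rmorphM => hh S' [<-|].
        by apply/HS => E; apply: hh; rewrite /= E mulr0.
      by apply: Hh => // E; apply: hh; rewrite /= E mul0r.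
    have [|y [py hy]] := blum M _ (map_mpoly g h) min_rel_has_order.
      by apply: contra_notN h0 => /eqP E; apply: (map_mpoly_inj g_inj);
        rewrite E rmorph0.
    exists (fun=> y) => S /(Hh y _ _); rewrite appE; apply; last exact/eqP.
    by apply/HSp.
exists (x 0%N); split.
  by rewrite upev_muni_inv; apply/HSp; rewrite -appE; apply: Hx; left.
move=> h E; apply: contrapT => h0.
have [S hS HS] := Def_dev_eq0 h.
have : ~ S (x 0%N .: e').
  rewrite -appE; apply: (Hx (fun e => ~ S e)); right; exists h; split=> //.
    exact: Def_not.
  by move=> y; rewrite HS.
by apply; apply/HS.
Qed.

(** [p] decides which polynomials of order at most $M$ vanish at $c$ and at $d$, so [G] below is an
    isomorphism between the fields generated by the derivatives up to order $M$. It respects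
    $\mathrm D$ because [p] determines the next derivative. *)
Lemma min_rel_extend d : upev D g d p = 0 ->
  (forall h : {mpoly A[M]}, dev D g d h = 0 -> h = 0) ->
  eqv k.+1 (c .: e) (d .: e').
Proof.
move=> pd gindep.
have gI : injective (@dev F D A g M d).
  move=> a b /eqP; rewrite -subr_eq0 -rmorphB => /eqP/gindep/eqP.
  by rewrite subr_eq0 => /eqP.
have fI := min_rel_dev_inj hp.
have key (q : {poly {mpoly A[M]}}) : upev D f c q = 0 <-> upev D g d q = 0.
  have mr := min_rel_min hp; split=> hq.
    refine (@root_transfer_to _ F (@dev F D A f M c) (@dev F D A g M d) gI _ _
      p _ _ mr pd q hq).
      exact: min_rel0 hp.
    exact: min_rel_root hp.
  refine (@root_transfer_from _ F (@dev F D A f M c) (@dev F D A g M d) fI gI _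
    _ p _ _ mr pd q hq).
    exact: min_rel0 hp.
  exact: min_rel_root hp.
pose G x x' := exists P Q : {poly {mpoly A[M]}}, [/\ upev D f c Q != 0,
  x = upev D f c P / upev D f c Q & x' = upev D g d P / upev D g d Q].
have key0 (q : {poly {mpoly A[M]}}) : upev D f c q != 0 -> upev D g d q != 0.
  by move=> h; apply: contra_neq h => /key.
have G0 x x' : G x x' -> (x == 0) = (x' == 0).
  move=> [P [Q [Q0 -> ->]]]; have Q0' := key0 _ Q0.
  rewrite !mulf_eq0 !invr_eq0 (negbTE Q0) (negbTE Q0') !orbF.
  by apply/eqP/eqP => /key.
have Gup (P : {poly {mpoly A[M]}}) : G (upev D f c P) (upev D g d P).
  by exists P, 1; rewrite !rmorph1 !divr1 oner_neq0.
have Gdev (h : {mpoly A[M]}) : G (@dev F D A f M c h) (@dev F D A g M d h).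
  by have := Gup h%:P; rewrite !upevC.
have Gfg a : G (f a) (g a) by have := Gdev a%:MP; rewrite !devC.
have GD x x' y y' : G x x' -> G y y' -> G (x + y) (x' + y').
  move=> [P [Q [Q0 -> ->]]] [P' [Q' [Q0' -> ->]]].
  exists (P * Q' + P' * Q), (Q * Q'); rewrite !rmorphD !rmorphM mulf_neq0 //.
  by rewrite !addf_div // ?key0.
have GM x x' y y' : G x x' -> G y y' -> G (x * y) (x' * y').
  move=> [P [Q [Q0 -> ->]]] [P' [Q' [Q0' -> ->]]].
  by exists (P * P'), (Q * Q'); rewrite !rmorphM mulf_neq0 // !mulf_div.
have GN x x' : G x x' -> G (- x) (- x').
  by move=> Gx; rewrite -[- x]mulN1r -[- x']mulN1r; apply: (GM) Gx;
    have := Gfg (-1); rewrite !rmorphN1.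
have GV x x' : G x x' -> G x^-1 x'^-1.
  move=> Gx; have := G0 _ _ Gx; case: Gx => [P [Q [Q0 -> ->]]].
  have Q0' := key0 _ Q0.
  have [->|P0] := eqVneq (upev D f c P) 0.
    rewrite mul0r eqxx => /esym/eqP ->; rewrite !invr0.
    by have := Gfg 0; rewrite !rmorph0.
  by move=> _; exists Q, P; rewrite !invf_div.
have fg_der a : exists2 b, f b = D (f a) & g b = D (g a) by exact: pair_der.
have Gcd i : (i <= M)%N -> G (iter i D c) (iter i D d).
  rewrite leq_eqVlt => /orP[/eqP->|lt].
    by have := Gup 'X; rewrite !upevX.
  by have := Gdev 'X_(Ordinal lt); rewrite !devX.
have GcdS : G (iter M.+1 D c) (iter M.+1 D d).
  have [x [x' [Gx E E']]] := rel_upev_der Dder GD GM Gfg fg_der Gcd p.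
  have sep := min_rel_separant char0 hp; have sep' := key0 _ sep.
  move: E E'; rewrite (min_rel_root hp) pd (der0 Dder) => /esym/eqP + /esym/eqP.
  rewrite !addr_eq0 => /eqP Ex /eqP Ex'.
  have -> : iter M.+1 D c = - x / upev D f c p^`() by rewrite Ex opprK mulrC
    mulKf.
  have -> : iter M.+1 D d = - x' / upev D g d p^`() by rewrite Ex' opprK mulrC
    mulKf.
  by apply: GM (GN _ _ Gx) (GV _ _ (Gup _)).
have Gder x x' : G x x' -> G (D x) (D x').
  have H (P : {poly {mpoly A[M]}}) : G (D (upev D f c P)) (D (upev D g d P)).
    have [y [y' [Gy -> ->]]] := rel_upev_der Dder GD GM Gfg fg_der Gcd P.
    by apply: GD Gy (GM _ _ _ _ (Gup _) GcdS).
  move=> [P [Q [Q0 -> ->]]].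
  have hP := H P; have hQ := H Q; have GQ := Gup Q.
  rewrite !(derM Dder) !(derV Dder) !expr2; apply: (GD).
    exact: (GM) (Gup P) ((GM) _ _ _ _ (GN _ _ hQ) (GV _ _ (GM _ _ _ _ GQ GQ))).
  exact: (GM) hP (GV _ _ GQ).
have GT T : Ter I k.+1 T -> G (T (c .: e)) (T (d .: e')).
  elim/(@Ter_ind F D t).
  - case=> [|i] lt; first exact: (Gcd 0%N).
    have [a Ea Ea'] := pair_of e e' (DT_var D t (n := k) (i := i) lt).
    by have := Gfg a; rewrite Ea Ea'.
  - by have := Gfg 0; rewrite !rmorph0.
  - by have := Gfg 1; rewrite !rmorph1.
  - have [a Ea Ea'] := pair_of e e' (DT_Ter (Ter_t t (ifun1 D) k)).
    by have := Gfg a; rewrite Ea Ea'.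
  - by move=> T1 T2; apply: (GD).
  - by move=> T1 T2; apply: (GM).
  - by move=> T1; apply: (Gder).
move=> T [T1 [T2 [/GT h1 /GT h2 E]]]; rewrite !E; apply: G0.
by apply: (GD) h1 (GN _ _ h2).
Qed.

End Algebraic.

(** A generic element is matched by any generic element, a differentially algebraic one by a copy of
    its minimal relation. *)
Lemma eqv_extend k e e' c : eqv k e e' ->
  exists d, eqv k.+1 (c .: e) (d .: e').
Proof.
move=> ee'; have [|hc] := pselect (cl k e c); last first.
  have [|//|d [_ hd]] := generic_exists char0 Dder Dt hsat (k := k) (z := e')
      (S := fun=> True).
    by apply: Def_ext (Def_not (Def_False _ _)) _ => e0; split=> // _ [].
  by exists d; apply: eqv_generic.
move=> [T hT [T0 [y0 Ty0]]]; pose f := pair1 D t k e e'.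
have fI : injective f := pair1_inj ee'.
have fder a : exists b, f b = D (f a) by have [b] := pair_der Dder a; exists b.
have fv T' : DT k T' -> exists a, f a = T' e.
  by move=> /(pair_of e e')[a]; exists a.
have [||N [P HP]] := DT_dev Dder fder (e := e) _ _ hT.
- by move=> i lt; apply: (fv (fun e => e i)); apply: DT_var.
- exact: (fv (fun=> t) (DT_Ter (Ter_t _ _ _))).
have P0 : P != 0 by apply: contra_neq Ty0 => E; rewrite HP E rmorph0.
rewrite HP in T0; have [M [p Hp]] := min_rel_exists fI P0 T0.
have [d [pd hd]] := min_rel_copy ee' Hp.
by exists d; apply: min_rel_extend pd hd.
Qed.

(** Quantifier elimination in semantic form: [eqv_extend] carries [eqv] through a quantifier. *)
Lemma eqv_sat L (J : interp L F) :
  (forall k T, Ter J k T -> Ter I k T) ->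
  (forall (r : rsym L) k e e', eqv k e e' ->
     forall T : 'I_(rar L r) -> (nat -> F) -> F, (forall i, Ter I k (T i)) ->
     rint J (r := r) [tuple T i e | i < rar L r] <->
     rint J (r := r) [tuple T i e' | i < rar L r]) ->
  forall k (phi : formula L k) e e', eqv k e e' ->
  sat J phi (etup k e) <-> sat J phi (etup k e').
Proof.
move=> JT JR k phi; elim: k / phi => [k|k u1 u2|k r us|k p IHp q IHq|k p IHp] e
  e' ee' //=.
- have h u : Ter I k (fun e => teval J (etup k e) u) by apply: JT; exists u.
  have := ee' _ (DT_sub (DT_Ter (h u1)) (DT_Ter (h u2))).
  by rewrite !subr_eq0 => E; split=> /eqP H; apply/eqP; rewrite ?E // -E.
- apply: (JR r k e e' ee' (fun i e => teval J (etup k e) (us i))) => i.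
  by apply: JT; exists (us i).
- by rewrite (IHp _ _ ee') (IHq _ _ ee').
- split=> H x.
    have [y /eqv_sym xy] := eqv_extend x (eqv_sym ee').
    by rewrite -etup_cons -(IHp _ _ xy) etup_cons.
  have [y xy] := eqv_extend x ee'.
  by rewrite -etup_cons (IHp _ _ xy) etup_cons.
Qed.

Lemma eqv_Def k S e e' : Def I k S -> eqv k e e' -> S e <-> S e'.
Proof.
by move=> [phi H] ee'; rewrite -!H; apply: eqv_sat ee' => // -[[[]|[]]|[]].
Qed.

End BackAndForth.

(** * The reduct *)

Lemma reductl_isum L1 L2 M (I1 : interp L1 M) (I2 : interp L2 M) :
  reductl (isum I1 I2) = I1.
Proof. by case: I1. Qed.

(** The translation is uniform in the structure, so that one sentence can be compared in $K$ and in
    $F$. *)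
Lemma reduct_translation L1 L2 k (phi : formula L1 k) n
    (s : 'I_k -> term (lsum L1 L2) n) :
  exists psi : formula (lsum L1 L2) n,
    forall M (I : interp (lsum L1 L2) M) (v : n.-tuple M),
    sat I psi v <-> sat (reductl I) phi [tuple teval I v (s i) | i < k].
Proof.
pose X := {M : Type & interp (lsum L1 L2) M}.
have [|||psi H] := @formula_translation L1 (lsum L1 L2) X (fun x => projT1 x)
  (fun x => reductl (projT2 x)) (fun x => projT2 x) (fun _ _ _ => True)
  _ _ _ k phi n s.
- by [].
- by move=> f m us; exists (@App (lsum L1 L2) m (inl f) us).
- by move=> r m us; exists (@Rel (lsum L1 L2) m (inl r) us).
by exists psi => M I v; apply: (H (existT _ M I)).
Qed.

(** The constant becomes the last variable. Quantifiers add variables in front, so the last place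
    keeps the value $c$ under them. *)
Lemma const_elimination L M (I : interp L M) (c : M) (u0 : term L 0) k
    (phi : formula (lsum L (Lconst unit)) k) :
  exists2 S, Def I k.+1 S & forall e, e k = c ->
    S e <-> sat (isum I (iconst (fun=> c))) phi (etup k e).
Proof.
pose J := isum I (iconst (fun _ : unit => c)).
pose P (x : unit) m (v : m.-tuple M) :=
  exists2 e, v = etup m e & (0 < m)%N /\ e m.-1 = c.
have [|||psi H] := @formula_translation (lsum L (Lconst unit)) L unit
  (fun=> M) (fun=> J) (fun=> I) P _ _ _ k phi k.+1
  (fun i => Var L (widen_ord (leqnSn k) i)).
- move=> x m y v [e -> [m0 em]]; exists (y .: e); first by rewrite etup_cons.
  by split=> //; rewrite /= -(prednK m0).
- move=> [f|[]] m us; first by exists (@App L m f us).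
  (* [P] excludes the empty tuple, for which [u0] is a default. *)
  case: m us => [|m] us; first by exists u0 => _ v [e _ []].
  by exists (Var L ord_max) => _ v [e -> [_ em]]; rewrite /= tnth_mktuple.
- by move=> [r|[]] m us; exists (@Rel L m r us).
exists (fun e => sat I psi (etup k.+1 e)); first by exists psi.
move=> e ek; rewrite (H tt); last by exists e.
rewrite (_ : [tuple _ | i < k] = etup k e) //.
by apply: eq_from_tnth => i; rewrite !tnth_mktuple /= tnth_mktuple.
Qed.

Lemma Def_exn L M (I : interp L M) n m S : Def I (n + m) S ->
  Def I m (fun e => exists x, S (eapp n x e)).
Proof.
elim: n S => [|n IH] S hS.
  apply: Def_ext hS _ => e.
  by split=> [?|[x]]; [exists e|]; rewrite eapp0.
apply: Def_ext (IH _ (Def_ex hS)) _ => e.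
split=> [[x [x0 h]]|[x h]].
  by exists (x0 .: x); rewrite eappS.
by exists (fun i => x i.+1), (x 0%N); rewrite -eappS.
Qed.

Section Reduct.
Variables (F : fieldType) (D : F -> F) (t a : F).
Variables (J : Type) (ar : J -> nat) (R : forall j : J, (ar j).-tuple F ->
  Prop).
Arguments R : clear implicits.
Hypothesis hDCF : DCF0 D.
Hypothesis Dt : D t = 1.
Hypothesis hsat : saturated (i_D D).
Hypothesis hR : forall j : J, definable (i_tD D t) (R j).
Hypothesis ha : diff_transcendental D (Q_adjoin t) a.

Local Notation I := (i_tD D t).
Local Notation IR := (i_R t R).
Local Notation DT := (DT D t).
Local Notation cl := (cl D t).
Local Notation fg := (fg D t).
Local Notation eqv := (eqv D t).
Implicit Types (n k : nat) (e z : nat -> F) (T : (nat -> F) -> F).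

Let char0 : [pchar F] =i pred0. Proof. by case: hDCF. Qed.
Let Dder : derivation +%R *%R D. Proof. by case: hDCF. Qed.

Lemma IR_Def k S : Def IR k S -> Def I k S.
Proof.
move=> hS; apply: (Def_transfer (s := fun i e => e i) _ _ hS).
- by move=> [f|[]] m T hT; apply: (@Ter_app _ _ I m (inl f)).
- move=> [[[]|[]]|j] m T hT; have [phi Hphi] := hR j.
  have hj : Def I (ar j) (fun e => R j (etup (ar j) e)) by exists phi.
  have := Def_subst (n := m) (s :=
    fun i e => if insub i is Some o then T o e else t) hj.
  move=> H; apply: Def_ext (H _) _.
    by move=> i lt; rewrite insubT; apply: hT.
  move=> e; rewrite (_ : etup _ _ = [tuple T i e | i < ar j]) //.
  by apply: eq_from_tnth => i; rewrite !tnth_mktuple valK.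
- by move=> i lt; apply: Ter_var.
Qed.

(** Without parameters an expression is a differential polynomial over $\mathbb Z[t]$, and its
    coefficients lie in $\mathbb Q(t)$. *)
Lemma generic_a z : ~ cl 0 z a.
Proof.
move=> [T hT [Ta [y0 Ty0]]].
pose f : {rmorphism {poly int} -> F} := horner_eval t \o map_poly intr.
have fE p : f p = (map_poly intr p).[t] by [].
have fC c : f c%:P = c%:~R by rewrite fE map_polyC hornerC.
have fX : f 'X = t by rewrite fE map_polyX hornerX.
have Dint (c : int) : D c%:~R = 0.
  have Dn n : D n%:R = 0 by apply: der_nat.
  by case: c => n; rewrite ?NegzE ?mulrNz ?(derN Dder) -?pmulrn ?Dn ?oppr0.
have fder p : exists q, f q = D (f p).
  elim/poly_ind: p => [|p c [q Hq]].
    by exists 0; rewrite rmorph0 (der0 Dder).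
  exists (p + q * 'X); rewrite !rmorphD !rmorphM fX fC (derD Dder) (derM Dder).
  by rewrite Dint Dt mulr1 addr0 Hq.
have [||N [P HP]] := DT_dev Dder fder (e := z) _ _ hT.
- by [].
- by exists 'X.
have P0 : map_mpoly f P = 0.
  apply: ha; last by rewrite -Ta HP.
  move=> m; rewrite (_ : _@_m = (map_poly intr P@_m).[t]); last first.
    exact: mcoeff_map_mpoly.
  exists (map_poly intr P@_m), 1.
  have mapr (p : {poly int}) : map_poly ratr (map_poly intr p) = map_poly intr
    p :> {poly F}.
    apply/polyP => i; rewrite coef_map_id0; last exact: (ratr_int F 0).
    by rewrite !coef_map /= ratr_int.
  rewrite mapr (_ : map_poly ratr 1 = 1) ?hornerC ?divr1 ?oner_neq0 //.
  by have := mapr 1; rewrite !rmorph1.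
by move/eqP: Ty0; case; rewrite HP /dev P0 /dpeval rmorph0.
Qed.

(** * Thin relations and the elementary substructure *)

Definition z0 : nat -> F := fun=> 0.

(* Relations are read at (y, x), not (x, y), in order that [Y (y .: x .: _)] be
   a condition on y over the parameter x. *)
Definition thin (Y : (nat -> F) -> Prop) :=
  Def IR 2 Y /\ forall x y, Y (y .: x .: z0) -> fg 1 (x .: z0) y.

Definition core (b : F) := exists2 Y, thin Y & Y (b .: a .: z0).

Lemma generic_above k z : exists y, ~ cl k z y.
Proof.
have [|//|y [_ hy]] := generic_exists char0 Dder Dt hsat (k := k) (z := z)
    (S := fun=> True); last by exists y.
by apply: Def_ext (Def_not (Def_False _ _)) _ => e; split=> // _ [].
Qed.

Lemma generic_Def k z S y y' : Def IR k.+1 S -> ~ cl k z y -> ~ cl k z y' ->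
  S (y .: z) -> S (y' .: z).
Proof.
move=> /IR_Def hS hy hy'.
by have [] := eqv_Def hDCF Dt hsat hS (eqv_generic hDCF Dt (fun T _ => erefl)
  hy hy').
Qed.

(* A first-order expression of non-genericity of the fibre of [S], in terms of
   the additive group alone. *)
Definition slim (S : (nat -> F) -> Prop) e :=
  forall g, exists y, ~ S (y .: e) /\ ~ S (y + g .: e).

Lemma Def_head k S T : Def IR k.+1 S -> Ter IR k.+2 T ->
  Def IR k.+2 (fun e => S (T e .: fun i => e i.+2)).
Proof.
move=> hS hT; have := Def_subst (n := k.+2)
  (s := fun i e => if i is j.+1 then e j.+2 else T e) hS.
move=> H; apply: Def_ext (H _) _; first by case=> [|i] lt //; apply: Ter_var.
move=> e; rewrite (_ : (fun i => _) = (T e .: fun i => e i.+2)) //.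
Qed.

Lemma Def_slim k S : Def IR k.+1 S -> Def IR k (slim S).
Proof.
move=> hS; have v i : (i < 2)%N -> Ter IR k.+2 (fun e => e i).
  by move=> lt; apply: Ter_var; lia.
have h1 := Def_head hS (v 0%N isT).
have h2 := Def_head hS (Ter_add (v 0%N isT) (v 1%N isT)).
exact: Def_all (Def_ex (Def_and (Def_not h1) (Def_not h2))).
Qed.

(** If [S] held at a generic element it would hold at all of them. For generic $g$, slimness gives
    $z$ and $z+g$ outside [S], hence both differentially algebraic, and then so is $g$. *)
Lemma slim_fg k S e y : Def IR k.+1 S -> slim S e -> S (y .: e) -> fg k e y.
Proof.
move=> hS Se Sy; apply: contrapT => hy.
have gen y' : ~ cl k e y' -> S (y' .: e).
  by move=> hy'; apply: generic_Def hS _ hy' Sy => /(cl_fg char0 Dder).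
have [g hg] := generic_above k e; have [z [Sz Szg]] := Se g; apply: hg.
have fgz y' : ~ S (y' .: e) -> fg k e y'.
  by move=> h; apply: (cl_fg char0 Dder); apply: contrapT => /gen.
apply: (fg_cl char0 Dder Dt); have -> : g = (z + g) - z by rewrite addrC addKr.
by apply: (fgB Dder); apply: fgz.
Qed.

Lemma fg_cons k e g y : fg k e y -> fg k.+1 (g .: e) y.
Proof.
apply: (fg_trans Dder) => i lt.
by apply: (@fg_DT F D t Dder _ _ (fun e => e i.+1)); apply: DT_var.
Qed.

(** Some $g$ puts $y$ or $y+g$ in [S] for each $y$. If [S] missed $\mathbb N[t]$, it would miss some
    $y$ generic over [e] and $g$; then $y+g$ is generic over [e] as well, and [S] misses both. *)
Lemma not_slim k S e : Def IR k.+1 S -> ~ slim S e ->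
  exists2 r, nat_t t r & S (r .: e).
Proof.
move=> hS /existsNP[g /forallNP Hg]; apply: contrapT => hr.
have hS' : Def IR k.+2 (fun e => S (e 0%N .: fun i => e i.+2)).
  exact/Def_head/Ter_var.
have [r nr|y [Sy hy]] := generic_exists char0 Dder Dt hsat (k := k.+1) (z :=
  g .: e)
    (Def_not (IR_Def hS')).
  by move=> Sr; apply: hr; exists r.
have hy1 y' : fg k e y' -> fg k.+1 (g .: e) y' by apply: fg_cons.
have hye : ~ cl k e y.
  by move=> /(cl_fg char0 Dder)/hy1/(fg_cl char0 Dder Dt).
have hyg : ~ cl k e (y + g).
  move=> /(cl_fg char0 Dder)/hy1 h; apply: hy; apply: (fg_cl char0 Dder Dt).
  have -> : y = (y + g) - g by rewrite addrK.
  apply: (fgB Dder) h _.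
  by apply: (@fg_DT F D t Dder _ _ (fun e => e 0%N)); apply: DT_var.
by apply: (Hg y); split=> //; apply: contra_not Sy => /(generic_Def hS hyg hye).
Qed.

Lemma core_tarski_vaught n (phi : formula (LRa ar) n.+1) (v : n.-tuple F) :
  (forall i, core (tnth v i)) ->
  (exists y, sat (i_Ra t a R) phi [tuple of y :: v]) ->
  exists2 y, core y & sat (i_Ra t a R) phi [tuple of y :: v].
Proof.
move=> core_v [y Hy].
have /choice[Y HY] i : exists Y, thin Y /\ Y (tnth v i .: a .: z0).
  by have [Y] := core_v i; exists Y.
pose u0 : term (LR ar) 0 := @App (LR ar) 0 (inl (inr tt)) 
  (fun i : 'I_0 => False_rect _ (notF (ltn_ord i))).
have [S hS HS] := const_elimination IR a u0 phi.
(* The parameters are followed by $a$, in the place that [const_elimination] reserves for the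
   constant. *)
pose w i := if insub i is Some o then tnth v o else a : F.
have wn : w n = a by rewrite /w insubF // ltnn.
have Ew : etup n w = v.
  by apply: eq_from_tnth => i; rewrite tnth_mktuple /w valK.
have HSy x : S (x .: w) <-> sat (i_Ra t a R) phi [tuple of x :: v].
  by rewrite HS // etup_cons Ew.
have [slimS|nslimS] := pselect (slim S w); last first.
  have [r nr Sr] := not_slim hS nslimS.
  exists r; last exact/HSy.
  exists (fun e => e 0%N = r) => //; split.
    by apply: Def_eq; [apply: Ter_var|apply: Ter_nat_t].
  move=> x z /= ->; apply: (@fg_DT F D t Dder _ _ (fun=> r)).
  exact/DT_Ter/Ter_nat_t.
exists y => //.
(* Places below [n] hold the parameters, place [n] the new element and place $n+1$ the base point.
   Slimness belongs to [W] because thinness is required over every base point, not over $a$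
   alone. *)
pose c (e : nat -> F) i := if (i < n)%N then e i else e n.+1.
pose W (e : nat -> F) := (forall i : 'I_n, Y i (e i .: e n.+1 .: z0)) /\
  (S (e n .: c e) /\ slim S (c e)).
have hW : Def IR (n + 2) W.
  have Tc i : Ter IR (n + 2) (fun e => c e i).
    by rewrite /c; case: ltnP => lt; apply: Ter_var; lia.
  apply: Def_and; last apply: Def_and.
  - apply: Def_fin => i; have [[hY _] _] := HY i.
    by apply: Def_subst2 => //; apply: Ter_var; have := ltn_ord i; lia.
  - have := Def_subst (n := n + 2) (s :=
      fun j e => if j is j'.+1 then c e j' else e n) hS.
    move=> H; apply: Def_ext (H _) _.
      by case=> [|j] lt //; apply: Ter_var; lia.
    by [].
  - exact: (Def_subst (n := n + 2) (s := fun j e => c e j) (Def_slim hS)).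
have E0 x e i : (i < n)%N -> eapp n x e i = x i by rewrite /eapp => ->.
have E1 x e : eapp n x e n = e 0%N by rewrite /eapp ltnn subnn.
have E2 x e : eapp n x e n.+1 = e 1%N by rewrite /eapp ltnNge leqnSn subSnn.
exists (fun e => exists x, W (eapp n x e)).
  split=> [|x z [u [HYu [Su slimu]]]]; first exact: Def_exn.
  move: HYu Su slimu; set E := eapp n u _ => HYu.
  rewrite {1}/E E1 /= => Su slimu.
  have := slim_fg hS slimu Su; apply: (fg_trans Dder) => i lt.
  rewrite /c; case: ltnP => lein; last first.
    by rewrite /E E2; apply: (@fg_DT F D t Dder _ _ (fun e => e 0%N));
      apply: DT_var.
  have [[_ th] _] := HY (Ordinal lein); apply: th.
  by have := HYu (Ordinal lein); rewrite /= {2}/E E2.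
exists w; rewrite /W E1 E2 /=.
have -> : c (eapp n w (y .: a .: z0)) = w.
  apply/funext => i; rewrite /c E2 /=; case: ltnP => lein; first by rewrite E0.
  by rewrite /w insubF //; lia.
split=> [i|]; last by split=> //; apply/HSy.
rewrite E0 // /w valK; by have [] := HY i.
Qed.

(** * The derivation of the substructure and the definability of $\mathrm D$ *)

Hypothesis hmodels : forall (K : Type) (J0 : interp (LRa ar) K),
  is_model J0 (theory (i_Ra t a R)) ->
  exists DK : K -> K,
    derivation (iadd (ring_of J0)) (imul (ring_of J0)) DK /\
    elem_equiv (isum J0 (ifun1 DK)) (isum (i_Ra t a R) (ifun1 D)).

Lemma core_a : core a.
Proof.
exists (fun e => e 0%N = e 1%N) => //; split.
  by apply: Def_eq; apply: Ter_var.
move=> x y /= ->; apply: (@fg_DT F D t Dder _ _ (fun e => e 0%N)).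
exact: DT_var.
Qed.

(** The type of [DK] alone puts $\mathrm D_K a$ in the core. The resulting sentence $Y(\mathrm D
    a,a)$ then passes to $F$ by elementary equivalence. *)
Lemma thin_derivative : exists2 Y, thin Y & Y (D a .: a .: z0).
Proof.
have [J0 HJ] := tarski_vaught (core_tarski_vaught).
have [phi|DK [_ DKE]] := hmodels (J0 := J0).
  by rewrite /theory /holds HJ (_ : map_tuple _ _ = [tuple]) // (tuple0
    (map_tuple _ _)).
pose aK : {x | core x} := exist _ a core_a; pose b := DK aK.
have [Y thY Yb] := svalP b; exists Y => //.
have [[phi Hphi] _] := thY.
pose no (L : language) n (i : 'I_0) : term L n :=
  False_rect _ (notF (ltn_ord i)).
have [phi1 H1] := reduct_translation phi (fun i : 'I_2 => Var (LRa ar) i).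
pose ca : term (lsum (LRa ar) Lfun1) 0 :=
  @App (lsum (LRa ar) Lfun1) 0 (inl (inr tt)) (@no _ _).
pose cda : term (lsum (LRa ar) Lfun1) 0 :=
  @App (lsum (LRa ar) Lfun1) 0 (inr tt) (fun _ => ca).
have [sigma Hs] := reduct_translation phi1
  (fun i : 'I_2 => if i == ord0 then cda else ca).
have E1 M (I0 : interp (LRa ar) M) v : sat I0 phi1 v <-> sat (reductl I0) phi v.
  rewrite H1 (_ : [tuple _ | i < 2] = v) //.
  by apply: eq_from_tnth => i; rewrite tnth_mktuple.
have EF v : sat (i_Ra t a R) phi1 v <-> sat IR phi v.
  by rewrite E1 reductl_isum.
have tup2 M (x y : M) u : u ord0 = x -> u ord_max = y ->
    [tuple u i | i < 2] = etup 2 (x .: fun=> y).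
  move=> ux uy; apply: eq_from_tnth => i; rewrite !tnth_mktuple.
  case: (unliftP ord0 i) => [j|] ->; last by rewrite ux.
  by rewrite (_ : lift ord0 j = ord_max) ?uy //; apply: val_inj;
    rewrite /= ord1.
(* Elementarity for the equation between a variable and the new constant shows that the latter names
   [aK]. *)
have aKE : teval J0 [tuple] (@App (LRa ar) 0 (inr tt) (@no _ _)) = aK.
  have [_ H] := HJ 1%N (Eq (Var _ ord0) (@App (LRa ar) 1 (inr tt) (@no _ _)))
    [tuple aK].
  have /= := H _; rewrite /tnth /= => ->.
    by congr (fint J0 _); apply: eq_from_tnth => -[].
  by [].
have /DKE : holds (isum J0 (ifun1 DK)) sigma.
  rewrite /holds Hs reductl_isum (tup2 _ b aK).
  - rewrite HJ EF (_ : map_tuple _ _ = etup 2 (sval b .: a .: z0)) ?Hphi //.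
    by apply: eq_from_tnth => -[[|[|]]] // ?; rewrite tnth_map !tnth_mktuple.
  - rewrite /= /b /thead tnth_mktuple -aKE /=; congr DK; congr (fint J0 _).
    by apply: eq_from_tnth => -[].
  - by rewrite -aKE /=; congr (fint J0 _); apply: eq_from_tnth => -[].
rewrite /holds Hs reductl_isum (tup2 _ (D a) a) //; last first.
  by rewrite /= /thead tnth_mktuple.
rewrite EF (_ : etup 2 _ = etup 2 (D a .: a .: z0)) ?Hphi //.
by apply: eq_etup => -[|[|]].
Qed.

Lemma derivative_invariant x x' y' :
  (forall S, Def IR 2 S -> S (D x .: x .: z0) -> S (y' .: x' .: z0)) ->
  y' = D x'.
Proof.
move=> Sinv; have [Y [hY thY] Ya] := thin_derivative.
apply: contrapT => y'n; pose u := y' - D x'.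
have u0 : u != 0 by rewrite subr_eq0; apply/eqP.
(* With $r,s$ placed before [z], these are $q=rx+s$, $w=rx'+s$ and $v=\mathrm Dw+ru$, the derivative
   of $w$ with $y'$ put for $\mathrm Dx'$. *)
pose z := x .: x' .: y' .: z0.
pose w (e : nat -> F) := e 0%N * e 3%N + e 1%N.
pose v (e : nat -> F) := D (e 0%N) * e 3%N + D (e 1%N) + e 0%N * e 4%N.
pose q (e : nat -> F) := e 0%N * e 2%N + e 1%N.
have tv i : (i < 5)%N -> Ter I 5 (fun e => e i) by apply: Ter_var.
have tw : Ter I 5 w by apply: Ter_add; [apply: Ter_mul|]; apply: tv.
have tq : Ter I 5 q by apply: Ter_add; [apply: Ter_mul|]; apply: tv.
have tv' : Ter I 5 v.
  by repeat (apply: Ter_add || apply: Ter_mul || apply: Ter_der || apply: tv).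
have Dpair T1 T2 : Ter I 5 T1 -> Ter I 5 T2 -> Def I 5 (fun e => Y (T1 e .: T2
  e .: z0)).
  exact: Def_subst2 (IR_Def hY).
have [||r [s [Srs gen]]] := generic_pair char0 Dder Dt hsat (k := 3) (z := z)
    (S := fun e => Y (D (q e) .: q e .: z0) -> Y (v e .: w e .: z0)).
- by apply: Def_imp; apply: Dpair => //; apply: Ter_der.
- move=> r s nr ns; rewrite /q /v /w /=.
  have -> : D (r * x + s) = D r * x + D s + r * D x.
    by rewrite (derD Dder) (derM Dder); ring.
  (* $r,s,\mathrm Dr,\mathrm Ds$ are values of closed terms here, so the implication is an instance
     of the hypothesis on types. *)
  apply: (Sinv (fun e => Y (D r * e 1%N + D s + r * e 0%N .: r * e 1%N + s .:
    z0))).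
  have cr n c : nat_t t c -> Ter IR n (fun=> c) by apply: Ter_nat_t.
  have nDr := nat_t_der Dder Dt nr; have nDs := nat_t_der Dder Dt ns.
  apply: Def_subst2 hY _ _; repeat (apply: Ter_add || apply: Ter_mul);
    by [apply: cr|apply: Ter_var].
have Yv : Y (v (r .: s .: z) .: w (r .: s .: z) .: z0).
  apply: Srs; set q0 := q _; have gq : ~ cl 0 z0 q0.
    move=> [T hT [Tq [y1 Ty1]]].
    have hT' : DT 5 (fun e => T (q e .: z0)).
      have H := DT_subst Dder (n := 5) (s :=
        fun j e => if j is _.+1 then 0 else q e) hT.
      apply: DT_ext (H _) _; first by case=> [|j] // _; apply: DT_Ter.
      by move=> e; congr T; apply/funext => -[].
    suff /(gen _ hT')/eqP : nonzero2 z (fun e => T (q e .: z0)) by apply.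
    (* With $r=0$ the element $rx+s$ takes every value, so a nonzero expression in it is nonzero in
       the pair. *)
    by exists 0, y1; rewrite /q /= mul0r add0r.
  have ga := generic_a (z := z0).
  have hYD : Def I 1 (fun e => Y (D (e 0%N) .: e 0%N .: z0)).
    by apply: Def_subst2 (IR_Def hY) _ _; [apply: Ter_der|]; apply: Ter_var.
  have [H _] := eqv_Def hDCF Dt hsat hYD
    (eqv_generic hDCF Dt (fun T _ => erefl) ga gq).
  exact: H Ya.
have /(fg_cl char0 Dder Dt)[T hT [Tv [v1 Tv1]]] := thY _ _ Yv.
set w0 := w (r .: s .: z) in Tv Tv1.
have hT' : DT 5 (fun e => T (v e .: w e .: z0)).
  have H := DT_subst Dder (n := 5) (s := fun j e => if j is j'.+1 then
    if j' is 0%N then w e else 0 else v e) hT.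
  apply: DT_ext (H _) _; first by case=> [|[|j]] // _; apply: DT_Ter.
  by move=> e; congr T; apply/funext => -[|[]].
suff /(gen _ hT')/eqP : nonzero2 z (fun e => T (v e .: w e .: z0)) by apply.
(* As $u\neq0$, the equations $rx'+s=w_0$ and $\mathrm Dw_0+ru=v_1$ are solvable in $r$ and $s$. *)
pose r1 := (v1 - D w0) / u; pose s1 := w0 - r1 * x'.
exists r1, s1; rewrite /v /w /=.
have -> : r1 * x' + s1 = w0 by rewrite /s1; ring.
suff -> : D r1 * x' + D s1 + r1 * y' = v1 by exact: Tv1.
rewrite /s1 (derB Dder) (derM Dder).
have -> : v1 = D w0 + r1 * u by rewrite /r1 divfK //; ring.
by rewrite /u; ring.
Qed.

Lemma derivative_definable : Def IR 2 (fun e => e 0%N = D (e 1%N)).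
Proof.
pose G (e : nat -> F) := e 0%N = D (e 1%N); apply: contrapT => nG.
have hG : Def I 2 G by apply: Def_eq; [|apply: Ter_der]; apply: Ter_var.
(* Otherwise compactness realizes the type of $(\mathrm Dx,x)$ in $\mathcal F_R$ off the graph,
   against [derivative_invariant]. *)
have sep x : exists S, [/\ Def IR 2 S, S (D x .: x .: z0) &
    forall e, S e -> G e].
  apply: contrapT => nS.
  pose Q S := S = (fun e => ~ G e) \/ (Def IR 2 S /\ S (D x .: x .: z0)).
  have [e He] : exists e, forall S, Q S -> S (eapp 2 e z0).
    apply: (compactness (t := t) char0 hsat (k := 0)).
      by move=> S [->|[/IR_Def]//]; apply: Def_not.
    move=> l lQ; pose l' := [seq S <- l | `[< S <> (fun e => ~ G e) >]].
    have l'P S : List.In S l' -> Def IR 2 S /\ S (D x .: x .: z0).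
      by move=> /List.filter_In[/lQ[->|//] /asboolP].
    have hC := Def_seq_all (fun S h => (l'P S h).1).
    have [e [Ce nGe]] : exists e, (forall S, List.In S l' -> S e) /\ ~ G e.
      apply: contrapT => /forallNP h; apply: nS.
      exists (fun e => forall S, List.In S l' -> S e); split=> //.
        by move=> S /l'P[].
      by move=> e Ce; apply: contrapT => nGe; apply: (h e).
    exists e => S lS; rewrite eapp2.
    have loc S' : Def I 2 S' -> S' e -> S' (e 0%N .: e 1%N .: z0).
      by move=> h; have [] := Def_local h (e := e) (e' :=
        e 0%N .: e 1%N .: z0) _ => // -[|[]].
    have [E|nE] := pselect (S = (fun e => ~ G e)).
      by rewrite E; apply: (loc (fun e => ~ G e)) => //; apply: Def_not.
    have /l'P[/IR_Def hS _] : List.In S l' by apply/List.filter_In; split=> //;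
      apply/asboolP.
    apply: loc hS _; apply: Ce; apply/List.filter_In; split=> //; exact/asboolP.
  have nGe : ~ G (eapp 2 e z0) by apply: (He (fun e => ~ G e)); left.
  apply: nGe; rewrite eapp2; apply: (@derivative_invariant x) => S hS Sx.
  by rewrite -(eapp2 e); apply: (He S); right.
(* If no finite union of definable subsets exhausted the graph, compactness would give a point of it
   outside all of them, against [sep]. *)
pose Q S := S = G \/ exists S', [/\ Def IR 2 S', forall e, S' e -> G e &
  S = fun e => ~ S' e].
have [e He] : exists e, forall S, Q S -> S (eapp 2 e z0).
  apply: (compactness (t := t) char0 hsat (k := 0)).
    by move=> S [->//|[S' [/IR_Def h _ ->]]]; apply: Def_not.
  move=> l lQ.
  have [U [hU UG Ul]] : exists U, [/\ Def IR 2 U, forall e, U e -> G e &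
      forall e, G e -> ~ U e -> forall S, List.In S l -> S e].
    elim: l lQ => [|S l IH] lQ.
      by exists (fun=> False); split=> //; apply: Def_False.
    have [U [hU UG Ul]] := IH (fun S' h => lQ S' (or_intror h)).
    have [->|[S' [hS' S'G ->]]] := lQ S (or_introl erefl).
      by exists U; split=> // e Ge nUe S' [<-//|]; apply: Ul.
    exists (fun e => S' e \/ U e); split; first exact: Def_or.
      by move=> e [/S'G|/UG].
    move=> e Ge nUe S'' [<- h|]; first by apply: nUe; left.
    by apply: Ul => // h; apply: nUe; right.
  have [e [Ge nUe]] : exists e, G e /\ ~ U e.
    apply: contrapT => /forallNP h; apply: nG; apply: Def_ext hU _ => e.
    by split=> [/UG//|Ge]; apply: contrapT => nUe; apply: (h e).
  exists e => S lS; have hS : Def I 2 S.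
    by have [->//|[S' [/IR_Def h _ ->]]] := lQ S lS; apply: Def_not.
  have [|h _] := Def_local hS (e := e) (e' := e 0%N .: e 1%N .: z0).
    by case=> [|[]].
  by rewrite eapp2; apply: h; apply: Ul lS.
have Ge : G (eapp 2 e z0) by apply: (He G); left.
have [S [hS Se SG]] := sep (e 1%N).
apply: (He (fun e => ~ S e)); first by right; exists S.
by rewrite eapp2; move: Ge; rewrite eapp2 /G /= => ->.
Qed.

Lemma graph_definable : definable IR (graph D).
Proof.
(* The coordinates are exchanged, since [graph] lists $x$ before $\mathrm Dx$. *)
have := Def_subst (n := 2) (s :=
  fun j (e : nat -> F) => if j is 0%N then e 1%N else e 0%N)
  derivative_definable.
move=> H; have [|phi Hphi] := H.
  by case=> [|[|]] // _; apply: Ter_var.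
exists phi => v; rewrite -(etup_nth 0 v) Hphi /=; split=> [E|[x E]].
  exists v`_0; apply: eq_from_tnth => -[[|[|]]] // ?.
    by rewrite tnth_mktuple.
  by rewrite tnth_mktuple E.
have := congr1 (fun w => tnth w ord0) E;
  have := congr1 (fun w => tnth w ord_max) E.
by rewrite !tnth_mktuple => /= -> ->.
Qed.

End Reduct.

Theorem theorem6p12 (F : fieldType) (D : F -> F) (t a : F)
    (J : Type) (ar : J -> nat) (R : forall j : J, (ar j).-tuple F -> Prop)
    (hF : DCF0 D)
    (hsat : saturated (i_D D))
    (ht : D t = 1)
    (hR : forall j : J, definable (i_tD D t) (R j))
    (ha : diff_transcendental D (Q_adjoin t) a)
    (hmodels : forall (K : Type) (I : interp (LRa ar) K),
       is_model I (theory (i_Ra t a R)) ->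
       exists DK : K -> K,
         derivation (iadd (ring_of I)) (imul (ring_of I)) DK /\
         elem_equiv (isum I (ifun1 DK)) (isum (i_Ra t a R) (ifun1 D))) :
  definable (i_R t R) (graph D).
Proof. exact: (graph_definable hF ht hsat hR ha hmodels). Qed.
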